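(* For any positive integers $d,t,D$ there exists a constant $C=C(d,t,D)>0$ with the following property. Let $\varepsilon>0$ and let $H=(P_1\cup\cdots\cup P_k,E)$ be any $k$-partite semi-algebraic hypergraph in $\mathbb{R}^d$ with complexity $(t,D)$ and $|E|\ge \varepsilon\prod_{i=1}^k|P_i|$. Then one can choose subsets $P_i'\subset P_i$, $1\le i\le k$, such that $$|P_i'|\ \ge\ \frac{\varepsilon^{\binom{d+D}{d}}}{C^k}\,|P_i| ,$$ and $P_1'\times\cdots\times P_k'\subseteq E$. Moreover, one can take $C=2^{20m\log(m+1)}\,t^{m/k}$, where $m=\binom{d+D}{d}-1$.
   Context: A $k$-uniform hypergraph $H=(P,E)$ has a finite vertex set $P$ and a set $E$ of $k$-element subsets of $P$. It is $k$-partite if $P$ is partitioned into $k$ parts $P=P_1\cup\cdots\cup P_k$ such that every edge has precisely one vertex in each part; then $E$ is identified with a subset of $P_1\times\cdots\times P_k$. A $k$-partite hypergraph $H=(P_1\cup\cdots\cup P_k,E)$ is semi-algebraic in $\mathbb{R}^d$ with complexity $(t,D)$ if its vertices are points of $\mathbb{R}^d$ and there are polynomials $f_1,\dots,f_t\in\mathbb{R}[x_1,\dots,x_{kd}]$ (viewed as functions of $k$ points of $\mathbb{R}^d$) and a Boolean function $\Phi$ such that for every $(p_1,\dots,p_k)\in P_1\times\cdots\times P_k$, $$(p_1,\dots,p_k)\in E\iff \Phi\big(f_1(p_1,\dots,p_k)\ge0;\dots;f_t(p_1,\dots,p_k)\ge0\big)=1,$$ and, for every $1\le j\le t$ and any fixed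 $q_1,\dots,q_{k-1}\in\mathbb{R}^d$, each of the $k$ $d$-variate polynomials $f_j(\mathbf{x},q_1,\dots,q_{k-1}),\ f_j(q_1,\mathbf{x},q_2,\dots,q_{k-1}),\ \dots,\ f_j(q_1,\dots,q_{k-1},\mathbf{x})$ has degree at most $D$. The logarithm $\log$ is to base $2$. *)

(* Defs.v *)
From HB Require Import structures.
From mathcomp Require Import all_boot all_order all_algebra.
From mathcomp Require Import finmap.
From mathcomp Require Import reals exp.
From mathcomp Require Import mpoly.

Set Implicit Arguments.
Unset Strict Implicit.
Unset Printing Implicit Defensive.

Import Order.TTheory GRing.Theory Num.Theory.

Local Open Scope fset_scope.
Local Open Scope ring_scope.

Record hypergraph (T : choiceType) := Hypergraph {
  vertices : {fset T};
  edges : {fset {fset T}};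
  edges_sub : forall e, e \in edges -> e `<=` vertices
}.

Definition uniform (T : choiceType) (k : nat) (H : hypergraph T) : Prop :=
  forall e, e \in edges H -> #|` e| = k.

(* The parts of a partition are nonempty, as with [finset.partition]. *)
Definition fpartition (T : choiceType) (k : nat) (P : {fset T})
    (parts : 'I_k -> {fset T}) : Prop :=
  [/\ forall i, parts i != fset0,
      forall i j, i != j -> [disjoint parts i & parts j]
    & forall x, x \in P <-> exists i, x \in parts i].

Definition kpartite (T : choiceType) (k : nat) (H : hypergraph T)
    (parts : 'I_k -> {fset T}) : Prop :=
  [/\ uniform k H,
      fpartition (vertices H) parts
    & forall e, e \in edges H -> forall i, #|` e `&` parts i| = 1%N].

(* The edge {p_1, ..., p_k} corresponding to the tuple (p_1, ..., p_k). *)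
Definition edge_of (T : choiceType) (k : nat) (p : 'I_k -> T) : {fset T} :=
  [fset p i | i : 'I_k].

Section SemiAlgebraic.
Variables (R : realType) (d k : nat).

(* A polynomial in k * d variables is a function of k points of R^d: coordinate
   j of the i-th point is the variable of index [mxvec_index i j]. *)
Definition eval_points (f : {mpoly R[k * d]}) (p : 'I_k -> 'rV[R]_d) : R :=
  f.@[mxvec (\matrix_(i < k, j < d) p i 0 j) 0].

(* The d-variate polynomial obtained from f by leaving the i-th point free and
   fixing every other point i' to q i'; the value q i is not used. *)
Definition free_point (f : {mpoly R[k * d]}) (i : 'I_k)
    (q : 'I_k -> 'rV[R]_d) : {mpoly R[d]} :=
  f \mPo [tuple mxvec (\matrix_(i' < k, j < d)
             (if i' == i then 'X_j else (q i' 0 j)%:MP)) 0 l | l < k * d].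

(* [msize] is one more than the total degree (and 0 for the zero polynomial). *)
Definition semialgebraic (t D : nat) (H : hypergraph 'rV[R]_d)
    (parts : 'I_k -> {fset 'rV[R]_d}) : Prop :=
  exists (f : 'I_t -> {mpoly R[k * d]}) (Phi : t.-tuple bool -> bool),
    (forall p : 'I_k -> 'rV[R]_d, (forall i, p i \in parts i) ->
       (edge_of p \in edges H) = Phi [tuple 0 <= eval_points (f j) p | j < t])
    /\
    (forall (j : 'I_t) (i : 'I_k) (q : 'I_k -> 'rV[R]_d),
       (msize (free_point (f j) i q) <= D.+1)%N).

End SemiAlgebraic.

Definition log2 (R : realType) (x : R) : R := ln x / ln 2.

(* Main.v *)
Require Import Defs.
From HB Require Import structures.
From mathcomp Require Import all_boot all_order all_algebra.
From mathcomp Require Import finmap.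
From mathcomp Require Import reals exp.
From mathcomp Require boolp classical_sets set_interval topology normedtype derive.
From mathcomp Require Import ring lra zify.
From mathcomp Require mpoly.

Set Implicit Arguments.
Unset Strict Implicit.
Unset Printing Implicit Defensive.

Import Order.TTheory GRing.Theory Num.Theory.

Local Open Scope fset_scope.
Local Open Scope ring_scope.

(** The proof picks the subsets one part at a time.  Let n = C(d+D,d).  As a
    function of a single one of its points, each polynomial runs through a
    space of dimension at most n, so that it is a linear functional in
    coordinates l(x) of R^n with sum 1 ([spanning_nodes], [meval_monomials]);
    a choice of the other points is thus a set of t hyperplanes of R^n.  What
    makes a subset usable is that few of these hyperplanes split it.

    The engine is a cutting lemma ([cutting]): for every s, finitely many
    points of R^n fall into at most (2 (s + n))^(n-1) classes, each class comes
    with n vectors of R^n, and for an average point only a fraction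
    n (n+1) / (s+1) of the given functionals takes both signs on the vectors of
    its class, up to a threshold; the functionals that do not take both signs
    have constant sign on the whole class.  There is no logarithmic factor, as
    the exponent of eps and the factor t^m require.

    To obtain it, perturb points and hyperplanes into general position and
    sample s functionals at random.  Each point p descends through the
    arrangement of the sample: let v be the point of minimal norm in the cell
    of p, remove from p the largest multiple of v for which it stays in the
    closed cell, and go on in the hyperplane so reached.  After n rounds p is a
    conic combination of n vectors lying in its closed cell ([descent_cone],
    [descent_cell]).  The sequence of hyperplanes reached, with the sides on
    which p lies, determines these vectors ([itinerary_descent]), which bounds
    the number of classes.  On the other hand the descent of p depends on at most n (n+1) sampled functionals:
    by a Helly argument the minimal norm in a polytope is sensitive to at most
    n constraints ([card_critical]).  Hence if s + 1 functionals are sampled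
    and a random one is set aside, it affects the descent of p, and so can
    split its class, with probability at most n (n+1) / (s+1)
    ([sum_crossed], [good_sample]).

    With s of the order of t / eps, averaging gives a class that contains a
    proportion of P_i of the order of eps (eps / t)^(n-1), and such that at
    least half of the expected number of tuples in the other parts are split by
    no functional and form edges with the whole class ([coordinate_step]).
    Whether a tuple is of this kind is decided by the signs of the functionals
    at the n vectors of the class, that is, by 2 n t functions of the remaining
    points which are again linear in the coordinates l of each of them.  So
    the step can be iterated over the k parts ([product_density]); after i
    rounds eps has become eps / 2^i and t has become (2 n)^i t, and these
    losses are absorbed by the factor C^k ([size_bound]). *)

(** * Scalar product and small perturbations *)

Section Dot.
Variables (R : realType) (n : nat).
Implicit Types (x y l : 'rV[R]_n).

Definition dot x (c : 'rV[R]_n) : R := \sum_i x 0 i * c 0 i.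

Lemma dotC x c : dot x c = dot c x.
Proof. by apply: eq_bigr => i _; rewrite mulrC. Qed.

Lemma dotDl x y c : dot (x + y) c = dot x c + dot y c.
Proof. by rewrite -big_split; apply: eq_bigr => i _; rewrite mxE mulrDl. Qed.

Lemma dotZl b x c : dot (b *: x) c = b * dot x c.
Proof. by rewrite mulr_sumr; apply: eq_bigr => i _; rewrite mxE mulrA. Qed.

Lemma dotNl x c : dot (- x) c = - dot x c.
Proof. by rewrite -scaleN1r dotZl mulN1r. Qed.

Lemma dotBl x y c : dot (x - y) c = dot x c - dot y c.
Proof. by rewrite dotDl dotNl. Qed.

Lemma dotDr x c l : dot x (c + l) = dot x c + dot x l.
Proof. by rewrite dotC dotDl !(dotC _ x). Qed.

Lemma dotZr b x c : dot x (b *: c) = b * dot x c.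
Proof. by rewrite dotC dotZl dotC. Qed.

Lemma dotNr x c : dot x (- c) = - dot x c.
Proof. by rewrite dotC dotNl dotC. Qed.

Lemma dotBr x c l : dot x (c - l) = dot x c - dot x l.
Proof. by rewrite dotDr dotNr. Qed.

Lemma dot0l c : dot 0 c = 0.
Proof. by rewrite -(scale0r 0) dotZl mul0r. Qed.

Lemma dot_suml (T : Type) (r : seq T) (P : pred T) (F : T -> 'rV[R]_n) c :
  dot (\sum_(i <- r | P i) F i) c = \sum_(i <- r | P i) dot (F i) c.
Proof.
by apply: (big_morph (dot^~ c)) => [x y|]; [exact: dotDl | exact: dot0l].
Qed.

Lemma dot_ge0 x : 0 <= dot x x.
Proof. by apply: sumr_ge0 => i _; rewrite -expr2 sqr_ge0. Qed.

Lemma dot_eq0 x : (dot x x == 0) = (x == 0).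
Proof.
apply/eqP/eqP => [x0|->]; last exact: dot0l.
apply/rowP => i; rewrite mxE.
have /psumr_eq0P: forall j, true -> 0 <= x 0 j * x 0 j.
  by move=> j _; rewrite -expr2 sqr_ge0.
move=> /(_ x0 i isT) /eqP; rewrite mulf_eq0 orbb => /eqP //.
Qed.

Lemma dot_gt0 x : x != 0 -> 0 < dot x x.
Proof. by move=> x0; rewrite lt_neqAle dot_ge0 eq_sym dot_eq0 x0. Qed.

Lemma dot_delta x i : dot x (delta_mx 0 i) = x 0 i.
Proof.
rewrite /dot (bigD1 i) //= mxE !eqxx mulr1 big1 ?addr0 // => j ji.
by rewrite mxE (negbTE ji) andbF mulr0.
Qed.

Lemma dot_const x b : dot x (const_mx b) = b * \sum_i x 0 i.
Proof. by rewrite mulr_sumr; apply: eq_bigr => i _; rewrite mxE mulrC. Qed.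

Lemma small_step x l (S : seq ('rV[R]_n * R)) :
  (forall c, c \in S -> 0 < dot x c.1 + c.2) ->
  exists2 e, 0 < e & forall c, c \in S -> 0 < dot (x + e *: l) c.1 + c.2.
Proof.
move=> xS.
suff [e e0 eS] : exists2 e, 0 < e & forall e', 0 < e' <= e ->
    forall c, c \in S -> 0 < dot (x + e' *: l) c.1 + c.2.
  by exists e => //; apply: eS; rewrite e0 lexx.
elim: S xS => [|c S IH] xS; first by exists 1.
have [|d d0 dS] := IH; first by move=> c' c'S; apply: xS; rewrite inE c'S orbT.
have c0 : 0 < dot x c.1 + c.2 by apply: xS; rewrite mem_head.
exists (Num.min d ((dot x c.1 + c.2) / (2 * (1 + `|dot l c.1|)))).
  by rewrite lt_min d0 divr_gt0 // mulr_gt0 // ltr_pwDl.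
move=> e /andP[e0]; rewrite le_min => /andP[ed ec] c'.
rewrite inE => /predU1P[->|/dS]; last by apply; rewrite e0.
rewrite dotDl dotZl.
move: ec; rewrite ler_pdivlMr; last by rewrite mulr_gt0 // ltr_pwDl.
move=> ec.
have := ler_norm (- dot l c.1); rewrite normrN => nl.
have nl0 := normr_ge0 (dot l c.1).
have : e * - dot l c.1 <= e * `|dot l c.1| by rewrite ler_pM2l.
nra.
Qed.

(** A move along [l] itself makes the product with [l] positive, and a short
    enough one keeps every strict inequality, among which those that record
    that the other members of [L] are already avoided. *)
Lemma perturb x (L : seq 'rV[R]_n) (S : seq ('rV[R]_n * R)) :
  (forall l, l \in L -> l != 0) ->
  (forall c, c \in S -> 0 < dot x c.1 + c.2) ->
  exists y, (forall l, l \in L -> dot y l != 0) /\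
            (forall c, c \in S -> 0 < dot y c.1 + c.2).
Proof.
move=> L0 xS; elim: L L0 => [|l L IH] L0; first by exists x.
have [|y [yL yS]] := IH; first by move=> l' l'L; apply: L0; rewrite inE l'L orbT.
have [yl|yl] := eqVneq (dot y l) 0; last first.
  by exists y; split=> // l'; rewrite inE => /predU1P[->|/yL].
pose S' := S ++ [seq (Num.sg (dot y c) *: c, 0) | c <- L].
have [|e e0 eS] := @small_step y l S'.
  move=> c; rewrite mem_cat => /orP[/yS //|/mapP[c' c'L ->]].
  by rewrite addr0 dotZr -normrEsg normr_gt0 yL.
exists (y + e *: l); split=> [l'|c cS]; last by apply: eS; rewrite mem_cat cS.
rewrite inE => /predU1P[->|l'L].
  by rewrite dotDl yl add0r dotZl gt_eqF // mulr_gt0 // dot_gt0 // L0 // mem_head.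
have /eS : (Num.sg (dot y l') *: l', 0) \in S'.
  by rewrite mem_cat; apply/orP; right; apply/mapP; exists l'.
rewrite addr0 dotZr.
by apply: contraTneq => ->; rewrite mulr0 ltxx.
Qed.

End Dot.

Lemma pos_lower_bound (R : realType) (s : seq R) : (forall y, y \in s -> 0 < y) ->
  exists2 e, 0 < e & forall y, y \in s -> e < y.
Proof.
elim: s => [|x s IH] s0; first by exists 1.
have [|e e0 es] := IH; first by move=> y ys; apply: s0; rewrite inE ys orbT.
have x0 : 0 < x by apply: s0; rewrite mem_head.
exists (Num.min (x / 2) e) => [|y]; first by rewrite lt_min divr_gt0.
by rewrite inE gt_min => /predU1P[->|/es ->]; rewrite ?orbT // ltr_pdivrMr // ltr_pMr ?ltr1n.
Qed.

(** * Points of minimal norm in polytopes *)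

Section MinNormExists.
Import boolp classical_sets set_interval topology normedtype derive.
Import numFieldNormedType.Exports.
Local Open Scope classical_set_scope.
Variables (R : realType) (n : nat).

Lemma continuous_dot (f g : 'rV[R]_n -> 'rV[R]_n) :
  (forall i, continuous (fun x => f x 0 i)) ->
  (forall i, continuous (fun x => g x 0 i)) ->
  continuous (fun x => dot (f x) (g x)).
Proof.
move=> fc gc; rewrite /dot; elim: (index_enum _) => [|i r IH] x.
  under eq_fun do rewrite big_nil; exact: cst_continuous.
under eq_fun do rewrite big_cons.
apply: cvgD; [exact: nbhs_filter| |exact: IH].
by apply: cvgM; [exact: nbhs_filter|exact: fc|exact: gc].
Qed.

(** The feasible set is closed in the standard simplex, hence compact. *)
Lemma min_norm_exists (L : seq 'rV[R]_n) :
  let feas (x : 'rV[R]_n) := [/\ forall i, 0 <= x 0 i, \sum_i x 0 i = 1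
                  & forall l, l \in L -> 0 <= dot x l] in
  (exists x, feas x) ->
  exists x, feas x /\ forall y, feas y -> dot x x <= dot y y.
Proof.
move=> feas [x0 fx0].
have dotc l : continuous (fun x : 'rV[R]_n => dot x l).
  apply: continuous_dot => i; first exact: coord_continuous.
  by move=> x; apply: cst_continuous.
have cpre (f : 'rV[R]_n -> R) (A : set R) :
    continuous f -> closed A -> closed (f @^-1` A).
  by move=> fc; apply: preimage_closed => x _; exact: fc.
have closed_dot l : closed [set x : 'rV[R]_n | 0 <= dot x l].
  by apply: (cpre (fun x => dot x l) [set y | 0 <= y]) => //; exact: closed_ge.
have fE : [set x | feas x] =
    [set x : 'rV[R]_n | forall i, `[0, 1] (x ord0 i)] `&`
    ([set x | dot x (const_mx 1) = 1] `&`
     \bigcap_(l in [set` L]) [set x | 0 <= dot x l]).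
  apply/seteqP; split=> x /=.
    move=> [x0' x1 xL]; split; last by rewrite dot_const mul1r; split.
    move=> i /=; rewrite in_itv /= x0' -x1 (bigD1 i) //= lerDl.
    by apply: sumr_ge0 => *; exact: x0'.
  case=> x01 []; rewrite dot_const mul1r => x1 xL; split=> // i.
  by have := x01 i; rewrite in_itv /= => /andP[].
have cF : compact [set x | feas x].
  rewrite fE; apply: compact_closedI.
    have := @rV_compact (R : realType) n (fun=> `[0, 1]%classic).
    by apply => _; exact: segment_compact.
  apply: closedI.
    by apply: (cpre (fun x => dot x (const_mx 1)) [set y | y = 1]) => //;
      exact: closed_eq.
  by apply: closed_bigI => l _.
have [||x xF xmin] := @EVT_min_rV R n (fun x => dot x x) _ _ cF.
- by exists x0.
- by apply: continuous_subspaceT; apply: continuous_dot => i;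
    exact: coord_continuous.
exists x; split; first by rewrite inE in xF.
by move=> y fy; apply: xmin; rewrite inE.
Qed.

End MinNormExists.

Lemma lin_dep (R : fieldType) (n : nat) (T : finType) (B : {set T})
    (x : T -> 'rV[R]_n) : (n < #|B|)%N ->
  exists c : T -> R, (exists2 i, i \in B & c i != 0) /\
                     \sum_(i in B) c i *: x i = 0.
Proof.
move=> nB; pose M := \matrix_(k < #|B|) x (enum_val k).
have kM : kermx M != 0.
  by rewrite -mxrank_eq0 mxrank_ker -lt0n subn_gt0 (leq_ltn_trans (rank_leq_col M)).
have [k uk] : exists k, row k (kermx M) != 0.
  apply/existsP; apply: contraR kM => /existsPn k0.
  by apply/eqP/row_matrixP => k; rewrite row0; apply/eqP; rewrite -[_ == _]negbK k0.
set u := row k (kermx M) in uk.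
have uM : u *m M = 0 by rewrite -row_mul mulmx_ker row0.
have [/set0Pn[t0 t0B]] : B != set0 by rewrite -card_gt0 (leq_ltn_trans _ nB).
pose c t := if t \in B then u 0 (enum_rank_in t0B t) else 0.
exists c; split.
  have [j uj] : exists j, u 0 j != 0 by apply/rV0Pn.
  exists (enum_val j); first exact: enum_valP.
  by rewrite /c enum_valP enum_valK_in.
rewrite big_enum_val; apply: etrans uM; rewrite mulmx_sum_row /=.
by apply: eq_bigr => j _; rewrite /c enum_valP enum_valK_in rowK.
Qed.

(** Makes a constraint on the sign of a functional linear in the functional,
    whichever sign is prescribed. *)
Definition sign_of (R : realType) (b : bool) : R := if b then 1 else -1.

Section Vmin.
Variables (R : realType) (n : nat) (I : finType) (a : I -> 'rV[R]_n).
Implicit Types (S Z : {set I}) (s : {ffun I -> bool}).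

(** The part of the standard simplex on the hyperplanes indexed by [Z] and on
    the sides prescribed by [s] of those indexed by [S].  Closed sides make it
    compact; the simplex stands for the projectivized positive orthant. *)
Definition cell S Z s (x : 'rV[R]_n) : Prop :=
  [/\ forall i, 0 <= x 0 i, \sum_i x 0 i = 1,
      forall z, z \in Z -> dot x (a z) = 0
    & forall i, i \in S -> 0 <= sign_of R (s i) * dot x (a i)].

Definition is_min_norm_pt S Z s x :=
  cell S Z s x /\ forall y, cell S Z s y -> dot x x <= dot y y.

(** By strict convexity the minimizer depends on the polytope alone and not on
    the constraints that describe it, so that it survives the removal of most
    of them. *)
Definition min_norm_pt S Z s : 'rV[R]_n :=
  if boolp.pselect (exists x, is_min_norm_pt S Z s x) is left h
  then sval (boolp.cid h) else 0.

Lemma min_norm_ptP S Z s x0 : cell S Z s x0 -> is_min_norm_pt S Z s (min_norm_pt S Z s).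
Proof.
move=> cx0; rewrite /min_norm_pt; case: boolp.pselect => [h|[]].
  exact: svalP (boolp.cid h).
pose L := [seq a z | z <- enum Z] ++ [seq - a z | z <- enum Z]
       ++ [seq sign_of R (s i) *: a i | i <- enum S].
have cE x : cell S Z s x <->
   [/\ forall i, 0 <= x 0 i, \sum_i x 0 i = 1
     & forall l, l \in L -> 0 <= dot x l].
  split=> [[x_ge0 x1 xZ xS]|[x_ge0 x1 xL]]; split=> //.
  - move=> l; rewrite !mem_cat => /or3P[] /mapP[i]; rewrite mem_enum => iS ->.
    + by rewrite xZ.
    + by rewrite dotNr xZ ?oppr0.
    + by rewrite dotZr xS.
  - move=> z zZ; apply/eqP; rewrite eq_le; apply/andP; split.
      rewrite -oppr_ge0 -dotNr; apply: xL; rewrite !mem_cat; apply/or3P/Or32.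
      by apply/mapP; exists z; rewrite ?mem_enum.
    apply: xL; rewrite !mem_cat; apply/or3P/Or31.
    by apply/mapP; exists z; rewrite ?mem_enum.
  - move=> i iS; rewrite -dotZr; apply: xL; rewrite !mem_cat; apply/or3P/Or33.
    by apply/mapP; exists i; rewrite ?mem_enum.
have [|x [/cE fx xmin]] := @min_norm_exists R n L; first by exists x0; apply/cE.
by exists x; split=> // y /cE; exact: xmin.
Qed.

Lemma min_norm_pt0 S Z s : ~ (exists x, cell S Z s x) -> min_norm_pt S Z s = 0.
Proof.
move=> nx; rewrite /min_norm_pt; case: boolp.pselect => // h; case: nx.
by case: h => x [cx _]; exists x.
Qed.

Lemma cell_comb S Z s (T : finType) (P : pred T) (c : T -> R) (x : T -> 'rV[R]_n) :
  (forall t, P t -> 0 <= c t) -> \sum_(t | P t) c t = 1 ->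
  (forall t, P t -> cell S Z s (x t)) ->
  cell S Z s (\sum_(t | P t) c t *: x t).
Proof.
move=> c0 c1 cx; split.
- move=> i; rewrite summxE; apply: sumr_ge0 => t Pt; rewrite mxE.
  by have [xt _ _ _] := cx t Pt; rewrite mulr_ge0 // c0.
- under eq_bigr do rewrite summxE; rewrite exchange_big /= -c1.
  apply: eq_bigr => t Pt; have [_ xt _ _] := cx t Pt.
  by under eq_bigr do rewrite mxE; rewrite -mulr_sumr xt mulr1.
- move=> z zZ; rewrite dot_suml big1 // => t Pt.
  by have [_ _ xt _] := cx t Pt; rewrite dotZl xt ?mulr0.
- move=> i iS; rewrite dot_suml mulr_sumr; apply: sumr_ge0 => t Pt.
  have [_ _ _ xt] := cx t Pt.
  by rewrite dotZl mulrCA mulr_ge0 ?c0 ?xt.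
Qed.

Lemma dot_sq_conv (b : R) (x y : 'rV[R]_n) :
  dot (b *: x + (1 - b) *: y) (b *: x + (1 - b) *: y) =
  b * dot x x + (1 - b) * dot y y - b * (1 - b) * dot (x - y) (x - y).
Proof.
rewrite !(dotDl, dotDr, dotNl, dotNr, dotZl, dotZr) (dotC y x); ring.
Qed.

(** The midpoint of two distinct minimizers would be shorter. *)
Lemma min_norm_pt_uniq S Z s y :
  cell S Z s y -> dot y y <= dot (min_norm_pt S Z s) (min_norm_pt S Z s) ->
  y = min_norm_pt S Z s.
Proof.
move=> cy yle; have [cv vle] := min_norm_ptP cy; set v := min_norm_pt S Z s in yle cv vle *.
apply/eqP; rewrite -subr_eq0 -dot_eq0 eq_le dot_ge0 andbT.
have : cell S Z s (2^-1 *: y + (1 - 2^-1) *: v).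
  have := @cell_comb S Z s _ predT (fun b : bool => if b then 2^-1 else 1 - 2^-1)
    (fun b => if b then y else v).
  rewrite !big_bool /=; apply; [case=> _; lra | lra | by case].
move=> /vle; rewrite dot_sq_conv; lra.
Qed.

Lemma eq_min_norm_pt S Z s S' Z' s' :
  (forall x, cell S Z s x <-> cell S' Z' s' x) ->
  min_norm_pt S Z s = min_norm_pt S' Z' s'.
Proof.
move=> e.
have [[x cx]|nx] := boolp.pselect (exists x, cell S Z s x).
  have [cv vle] := min_norm_ptP cx; have [cv' vle'] := min_norm_ptP ((e x).1 cx).
  by apply: min_norm_pt_uniq; [exact/e | apply/vle/e].
by rewrite !min_norm_pt0 // => -[x cx]; apply: nx; exists x => //; apply/e.
Qed.

Lemma cell_sub S S' Z s x : S' \subset S -> cell S Z s x -> cell S' Z s x.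
Proof. by move=> /fintype.subsetP SS [? ? ? xS]; split=> // i /SS /xS. Qed.

(** An open ball around 0 is convex. *)
Lemma dot_sq_comb (T : finType) (P : pred T) (c : T -> R) (x : T -> 'rV[R]_n) b :
  (forall t, P t -> 0 <= c t) -> \sum_(t | P t) c t = 1 ->
  (forall t, P t -> dot (x t) (x t) < b) ->
  dot (\sum_(t | P t) c t *: x t) (\sum_(t | P t) c t *: x t) < b.
Proof.
move=> c0 c1 xb; set y := \sum_(t | P t) _.
have yE : dot y y = \sum_(t | P t) c t * dot (x t) y.
  by rewrite {1}/y dot_suml; apply: eq_bigr => t _; rewrite dotZl.
have [t0 Pt0 ct0] : exists2 t, P t & 0 < c t.
  have [[t Pt ct]|nt] := boolp.pselect (exists2 t, P t & 0 < c t); first by exists t.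
  have : (1 : R) <= 0.
    rewrite -c1; apply: sumr_le0 => t Pt; rewrite leNgt; apply/negP => ct.
    by apply: nt; exists t.
  by rewrite ler10.
have h t : P t -> 2 * dot (x t) y <= dot (x t) (x t) + dot y y.
  move=> Pt; have := dot_ge0 (x t - y).
  rewrite !(dotDl, dotDr, dotNl, dotNr) (dotC y (x t)); lra.
have : \sum_(t | P t) c t * (2 * dot (x t) y) < \sum_(t | P t) c t * (b + dot y y).
  rewrite (bigD1 t0) //= [ltRHS](bigD1 t0) //=; apply: ltr_leD.
    rewrite ltr_pM2l //; apply: le_lt_trans (h _ Pt0) _.
    by rewrite ltrD2r xb.
  apply: ler_sum => t /andP[Pt _]; rewrite ler_wpM2l ?c0 //.
  by apply: le_trans (h _ Pt) _; rewrite lerD2r ltW // xb.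
rewrite -mulr_suml c1 mul1r.
under eq_bigr do rewrite mulrCA.
rewrite -mulr_sumr -yE; lra.
Qed.

Definition critical S Z s : {set I} :=
  [set i in S | min_norm_pt (S :\ i) Z s != min_norm_pt S Z s].

(** A Helly-type bound.  If more than [n] constraints were critical, the
    minimizers [x i] obtained by dropping one critical constraint each would be
    linearly dependent.  Separating the signs in a dependency writes one point
    [y] as a convex combination of [x i] in two ways, over disjoint sets of
    indices.  A constraint [j] holds at all [x i] with [i != j], hence at all
    points of one of the two combinations, hence at [y].  So [y] lies in the
    full polytope, but like all the [x i] it is shorter than the minimizer. *)
Lemma card_critical S Z s x0 : cell S Z s x0 -> (#|critical S Z s| <= n)%N.
Proof.
move=> cx0; have [cv vle] := min_norm_ptP cx0.
set v := min_norm_pt S Z s in cv vle *.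
pose x i := min_norm_pt (S :\ i) Z s.
have cvi i : cell (S :\ i) Z s v by apply: cell_sub cv; exact: subD1set.
have cx i : cell (S :\ i) Z s (x i) by have [] := min_norm_ptP (cvi i).
have xv i : i \in critical S Z s -> dot (x i) (x i) < dot v v.
  rewrite inE => /andP[_ neq]; rewrite lt_neqAle (min_norm_ptP (cvi i)).2 // andbT.
  apply: contra neq => /eqP e; apply/eqP/esym/min_norm_pt_uniq => //.
  by rewrite -/(x i) e.
rewrite leqNgt; apply/negP => /(lin_dep x)[c [[i0 i0C ci0] cx0']].
pose P i := (i \in critical S Z s) && (0 < c i).
pose N i := (i \in critical S Z s) && ~~ (0 < c i).
pose M := \sum_(i | P i) c i.
have sumx i : \sum_j x i 0 j = 1 by have [] := cx i.
have PN : \sum_(i | P i) c i *: x i = \sum_(i | N i) (- c i) *: x i.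
  apply/eqP; rewrite -subr_eq0 -sumrN; apply/eqP.
  rewrite -[RHS]cx0' [RHS](bigID (fun i => 0 < c i)) /=; congr (_ + _).
  by apply: eq_bigr => i _; rewrite scaleNr opprK.
have MN : M = \sum_(i | N i) (- c i).
  have := congr1 (fun y => dot y (const_mx 1)) PN.
  rewrite !dot_suml => e; rewrite /M.
  transitivity (\sum_(i | P i) dot (c i *: x i) (const_mx 1)).
    by apply: eq_bigr => i _; rewrite dotZl dot_const sumx !mulr1.
  by rewrite e; apply: eq_bigr => i _; rewrite dotZl dot_const sumx !mulr1.
have M0 : 0 < M.
  have Mge0 : 0 <= M by apply: sumr_ge0 => i /andP[_ /ltW].
  rewrite lt_neqAle eq_sym Mge0 andbT; apply: contra ci0 => /eqP M0.
  have [ci|ci] := boolP (0 < c i0).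
    have Pge i : P i -> 0 <= c i by move=> /andP[_ /ltW].
    by rewrite (psumr_eq0P Pge M0 (i := i0)) // /P i0C ci.
  have NM := esym MN; rewrite M0 in NM.
  have Nge i : N i -> 0 <= - c i by move=> /andP[_]; rewrite -leNgt oppr_ge0.
  by rewrite -oppr_eq0 (psumr_eq0P Nge NM (i := i0)) // /N i0C ci.
pose y := \sum_(i | P i) (c i / M) *: x i.
have yN : y = \sum_(i | N i) (- c i / M) *: x i.
  have e (Q : pred I) (d : I -> R) :
      \sum_(i | Q i) (d i / M) *: x i = M^-1 *: \sum_(i | Q i) d i *: x i.
    by rewrite scaler_sumr; apply: eq_bigr => i _; rewrite scalerA mulrC.
  by rewrite /y !e PN.
have Pc i : P i -> 0 <= c i / M by move=> /andP[_ ci]; rewrite divr_ge0 ?ltW.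
have Nc i : N i -> 0 <= - c i / M.
  by move=> /andP[_]; rewrite -leNgt => ci; rewrite divr_ge0 ?oppr_ge0 //; exact: ltW.
have P1 : \sum_(i | P i) c i / M = 1 by rewrite -mulr_suml divff ?gt_eqF.
have N1 : \sum_(i | N i) - c i / M = 1.
  by rewrite -mulr_suml -MN divff ?gt_eqF.
have yv : dot y y < dot v v.
  by apply: dot_sq_comb => // i /andP[iC _]; exact: xv.
have cy : cell S Z s y.
  have c0 : cell set0 Z s y.
    by apply: cell_comb => // i _; apply: cell_sub (cx i); exact: sub0set.
  have [y0 y1 yZ _] := c0; split=> // j jS.
  have yj : cell [set j] Z s y.
    have [jP|jP] := boolP (P j).
      rewrite yN; apply: cell_comb => // i Ni; apply: cell_sub (cx i).
      rewrite sub1set !inE jS andbT; apply: contraTneq jP => ->.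
      by move: Ni => /andP[_]; rewrite /P negb_and => ->; rewrite orbT.
    apply: cell_comb => // i Pi; apply: cell_sub (cx i).
    rewrite sub1set !inE jS andbT; apply: contraNneq jP => -> //.
  by have [_ _ _] := yj; apply; rewrite inE.
by have := vle _ cy; rewrite leNgt yv.
Qed.

End Vmin.

(** * Descent of a point through an arrangement of hyperplanes *)

Lemma same_sign (R : realDomainType) (x y : R) :
  x != 0 -> y != 0 -> (0 < x) = (0 < y) -> 0 < x * y.
Proof.
move=> x0 y0; case: (ltrP 0 x) => hx; case: (ltrP 0 y) => // hy _.
  exact: mulr_gt0.
by rewrite nmulr_rgt0 lt_neqAle ?x0 ?y0.
Qed.

Lemma mul_gt0_shift (R : realDomainType) (x y x' y' : R) :
  0 < x' * x -> 0 < y' * y -> 0 < x' * y' -> 0 < x * y.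
Proof.
move=> xx yy xy; have : 0 < x' * y' * (x * y).
  by have := mulr_gt0 xx yy; rewrite mulrACA.
by rewrite pmulr_rgt0.
Qed.

(** The coordinate functionals are among the [a i] so that the cells are
    pointed cones; the independence of any [n] functionals says that the
    arrangement is simple. *)
Section Descent.
Variables (R : realType) (n : nat) (I : finType) (a : I -> 'rV[R]_n).
Variable co : 'I_n -> I.
Hypothesis aco : forall c, a (co c) = delta_mx 0 c.
Hypothesis indep : forall (Z : {set I}) (c : I -> R), (#|Z| <= n)%N ->
  \sum_(z in Z) c z *: a z = 0 -> forall z, z \in Z -> c z = 0.
Implicit Types (S Z : {set I}) (p v : 'rV[R]_n) (b : {ffun I -> 'rV[R]_n}).

Lemma indep_span Z x : #|Z| = n -> (forall z, z \in Z -> dot x (a z) = 0) -> x = 0.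
Proof.
move=> Zn xZ.
pose A := \matrix_(k < #|Z|) a (enum_val k).
have fA : row_free A.
  apply: inj_row_free => u uA; apply/rowP => k; rewrite mxE.
  have [z0 z0Z] : exists z0, z0 \in Z by exists (enum_val k); exact: enum_valP.
  pose c t := u 0 (enum_rank_in z0Z t).
  have Zle : (#|Z| <= n)%N by rewrite Zn.
  have := @indep Z c Zle.
  rewrite big_enum_val => /(_ _ (enum_val k) (enum_valP k)).
  rewrite /c enum_valK_in; apply; apply: etrans uA; rewrite mulmx_sum_row /=.
  by apply: eq_bigr => j _; rewrite enum_valK_in rowK.
have fuA : row_full A by rewrite /row_full (eqP fA) Zn.
apply: trmx_inj; apply: (row_full_inj fuA); rewrite trmx0 mulmx0.
apply/colP => k; rewrite !mxE -[RHS](xZ _ (enum_valP k)).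
by apply: eq_bigr => j _; rewrite !mxE mulrC.
Qed.

Lemma co_inj : injective co.
Proof.
move=> c d /(congr1 a); rewrite !aco => /matrixP/(_ 0 c); rewrite !mxE !eqxx.
by case: eqP => // _ /eqP; rewrite oner_eq0.
Qed.

Lemma free_coord Z : (#|Z| < n)%N -> exists c, co c \notin Z.
Proof.
move=> Zn; apply/existsP; apply: contraLR Zn => /existsPn coZ.
rewrite -leqNgt -[X in (X <= _)%N](card_ord n) -(card_imset _ co_inj).
by apply/subset_leq_card/fintype.subsetP => _ /imsetP[c _ ->]; rewrite -[_ \in _]negbK coZ.
Qed.

(** Projecting a point along [v] onto the hyperplane [a h] is linear in the
    point: if the [b i] evaluate the functionals [a i] at the current point in
    terms of the starting point, then [pull_back v h b] does so after the
    projection. *)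
Definition pull_back v h b : {ffun I -> 'rV[R]_n} :=
  [ffun i => b i - (dot v (a i) / dot v (a h)) *: b h].

Definition min_norm_pts : seq 'rV[R]_n :=
  [seq min_norm_pt a k.1.1 k.1.2 k.2 |
    k <- enum {: {set I} * {set I} * {ffun I -> bool}}].

(** Lists all pull-backs along [j] projections, whatever the starting point;
    since the list is finite, a point can be chosen to suit all of them. *)
Fixpoint pull_backs j : seq {ffun I -> 'rV[R]_n} :=
  if j is j'.+1 then
    [seq pull_back vh.1 vh.2 b | vh <- [seq (v, h) | v <- min_norm_pts, h <- enum I],
                             b <- pull_backs j']
  else [:: [ffun i => a i]].

(** A nonzero pull-back vanishes at [p] only by accident. *)
Definition generic p := (forall c, 0 < p 0 c) /\
  forall j, (j < n)%N -> forall b, b \in pull_backs j -> forall i, b i != 0 ->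
  dot p (b i) != 0.

(** The state of the descent from [p0] after projections onto the hyperplanes
    in [Z].  The projections only add multiples of these to a functional,
    which is why a functional outside [Z] cannot have become zero. *)
Definition reach p0 Z p :=
  [/\ exists b, [/\ b \in pull_backs #|Z|, forall i, dot p (a i) = dot p0 (b i)
      & forall i, exists c : I -> R, b i = a i + \sum_(z in Z) c z *: a z],
      forall z, z \in Z -> dot p (a z) = 0
    & forall c, 0 <= p 0 c].

Definition sgn p : {ffun I -> bool} := [ffun i => 0 < dot p (a i)].

Lemma sgn_mul p i : sign_of R (sgn p i) * dot p (a i) = `|dot p (a i)|.
Proof.
rewrite ffunE /sign_of; case: ltrP => [x0|x0]; first by rewrite mul1r gtr0_norm.
by rewrite mulN1r ler0_norm.
Qed.

Lemma sign_of_ge0 p i (y : R) : dot p (a i) != 0 ->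
  (0 <= sign_of R (sgn p i) * y) = (0 <= y * dot p (a i)).
Proof.
rewrite ffunE /sign_of; case: ltgtP => // [x0|x0] _.
  by rewrite mul1r pmulr_lge0.
by rewrite mulN1r oppr_ge0 nmulr_lge0.
Qed.

Lemma reach0 p : generic p -> reach p set0 p.
Proof.
move=> [p0 _]; split; last by move=> c; rewrite ltW.
  exists [ffun i => a i]; rewrite cards0 inE eqxx; split=> // i; rewrite ffunE //.
  by exists (fun=> 0); rewrite big_set0 addr0.
by move=> z; rewrite inE.
Qed.

Section State.
Variables (p0 : 'rV[R]_n).
Hypothesis gp0 : generic p0.

Lemma reach_neq0 Z p i :
  reach p0 Z p -> (#|Z| < n)%N -> i \notin Z -> dot p (a i) != 0.
Proof.
case=> -[b [bf pb bE] _ _] Zn iZ; rewrite pb; apply: (gp0.2 _ Zn _ bf).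
have [c ->] := bE i; apply/eqP => c0.
have := @indep (i |: Z) (fun z => if z == i then 1 else c z).
rewrite cardsU1 iZ add1n => /(_ Zn) H.
have /H : \sum_(z in i |: Z) (if z == i then 1 else c z) *: a z = 0.
  rewrite big_setU1 //= eqxx scale1r -[RHS]c0; congr (_ + _).
  by apply: eq_bigr => z zZ; case: eqP zZ iZ => // -> ->.
move=> /(_ i); rewrite setU11 eqxx => /(_ isT) /eqP.
by rewrite oner_eq0.
Qed.

Lemma reach_sum_gt0 Z p : reach p0 Z p -> (#|Z| < n)%N -> 0 < \sum_c p 0 c.
Proof.
move=> rp Zn; have [c cZ] := free_coord Zn; have [_ _ pge] := rp.
rewrite (bigD1 c) //= ltr_pwDl ?sumr_ge0 // lt_neqAle pge andbT eq_sym.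
by rewrite -dot_delta -aco; apply: reach_neq0 cZ.
Qed.

Lemma reach_cell S Z p : reach p0 Z p -> (#|Z| < n)%N ->
  cell a S Z (sgn p) ((\sum_c p 0 c)^-1 *: p).
Proof.
move=> rp Zn; have s0 := reach_sum_gt0 rp Zn; have [_ pZ pge] := rp.
split.
- by move=> i; rewrite mxE mulr_ge0 // invr_ge0 ltW.
- by under eq_bigr do rewrite mxE; rewrite -mulr_sumr mulVf ?gt_eqF.
- by move=> z zZ; rewrite dotZl pZ ?mulr0.
- by move=> i _; rewrite dotZl mulrCA sgn_mul mulr_ge0 // invr_ge0 ltW.
Qed.

End State.

(** The functionals that decrease in absolute value as multiples of [v] are
    removed from [p]: they limit the move. *)
Definition blocking S Z v p i := (i \in S :\: Z) && (0 < dot v (a i) * dot p (a i)).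

Definition ratio v p i : R := dot p (a i) / dot v (a i).

Definition hit S Z v p : option I :=
  [pick i | blocking S Z v p i &&
     [forall j, blocking S Z v p j ==> (ratio v p i <= ratio v p j)]].

Definition shoot v h p := p - ratio v p h *: v.

Lemma hitP S Z v p h : hit S Z v p = Some h ->
  blocking S Z v p h /\ forall j, blocking S Z v p j -> ratio v p h <= ratio v p j.
Proof.
rewrite /hit; case: pickP => // i /andP[ci /forallP iP] [<-]; split=> // j cj.
by have := iP j; rewrite cj.
Qed.

Section Shot.
Variables (p0 : 'rV[R]_n) (S Z : {set I}) (p v : 'rV[R]_n).
Hypotheses (gp0 : generic p0) (coS : forall c, co c \in S).
Hypotheses (rp : reach p0 Z p) (Zn : (#|Z| < n)%N) (cv : cell a S Z (sgn p) v).

Lemma hit_ex : exists h, hit S Z v p = Some h.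
Proof.
rewrite /hit; case: pickP => [h _|nh]; first by exists h.
have [v0 v1 vZ vS] := cv.
have [c vc] : exists c, 0 < v 0 c.
  apply/existsP; apply: contraT => /existsPn vle.
  have : \sum_c v 0 c <= 0 by apply: sumr_le0 => c _; rewrite leNgt vle.
  by rewrite v1 ler10.
have cZ : co c \notin Z.
  by apply/negP => /vZ; rewrite aco dot_delta => v0c; rewrite v0c ltxx in vc.
have cc : blocking S Z v p (co c).
  rewrite /blocking !inE cZ coS /= aco !dot_delta mulr_gt0 //.
  have [_ _ pge] := rp; rewrite lt_neqAle pge andbT eq_sym.
  by rewrite -dot_delta -aco (reach_neq0 gp0 rp).
have := nh [arg min_(i < co c | blocking S Z v p i) ratio v p i]%O.
case: Order.TotalTheory.arg_minP => //= i -> imin /negbT/negP[].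
by apply/forallP => j; apply/implyP => /imin.
Qed.

Lemma cell_mul_ge0 i : i \in S -> 0 <= dot v (a i) * dot p (a i).
Proof.
move=> iS; have [_ _ vZ vS] := cv; have [iZ|iZ] := boolP (i \in Z).
  by rewrite vZ ?mul0r.
by rewrite -sign_of_ge0 ?vS // (reach_neq0 gp0 rp).
Qed.

Variable h : I.
Hypothesis hh : hit S Z v p = Some h.
Let p' := shoot v h p.

Lemma hit_inS : h \in S. Proof. by have [/andP[/setDP[]]] := hitP hh. Qed.

Lemma hit_notinZ : h \notin Z. Proof. by have [/andP[/setDP[]]] := hitP hh. Qed.

Lemma hit_mul_gt0 : 0 < dot v (a h) * dot p (a h).
Proof. by have [/andP[]] := hitP hh. Qed.

Lemma hit_neq0 : dot v (a h) != 0.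
Proof. by apply: contraTneq hit_mul_gt0 => ->; rewrite mul0r ltxx. Qed.

Lemma ratio_gt0 : 0 < ratio v p h.
Proof.
have := hit_mul_gt0; rewrite /ratio mulrC => hm.
have -> : dot p (a h) / dot v (a h) = dot p (a h) * dot v (a h) / (dot v (a h) ^+ 2).
  by field; exact: hit_neq0.
by rewrite divr_gt0 // lt_neqAle sqr_ge0 andbT eq_sym sqrf_eq0 hit_neq0.
Qed.

Lemma shootE i : dot p' (a i) = dot p (a i) - ratio v p h * dot v (a i).
Proof. by rewrite dotBl dotZl. Qed.

(** No functional changes its sign before the first one to vanish does. *)
Lemma shoot_mul_ge0 i : i \in S -> 0 <= dot p' (a i) * dot p (a i).
Proof.
move=> iS; rewrite shootE.
have vp := cell_mul_ge0 iS.
have [ci|] := boolP (blocking S Z v p i).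
  have := (hitP hh).2 i ci; move: ci => /andP[_ vp0].
  have vi : dot v (a i) != 0 by apply: contraTneq vp0 => ->; rewrite mul0r ltxx.
  move=> le; have : ratio v p h * (dot v (a i) * dot p (a i)) <=
      ratio v p i * (dot v (a i) * dot p (a i)) by rewrite ler_pM2r.
  have -> : ratio v p i * (dot v (a i) * dot p (a i)) = dot p (a i) ^+ 2.
    by rewrite /ratio; field.
  by rewrite mulrBl -expr2 subr_ge0 mulrA.
rewrite /blocking inE iS andbT negb_and negbK => /orP[iZ|].
  by have [_ pZ _] := rp; rewrite pZ ?mulr0.
rewrite -leNgt => vp'; have /eqP : dot v (a i) * dot p (a i) = 0 by apply/eqP; rewrite eq_le vp vp'.
rewrite mulf_eq0 => /orP[]/eqP->; last by rewrite mulr0.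
by rewrite mulr0 subr0 -expr2 sqr_ge0.
Qed.

Lemma reach_shoot : v \in min_norm_pts -> reach p0 (h |: Z) p'.
Proof.
move=> vW; have hZ := hit_notinZ; have vh := hit_neq0.
have [[b [bf pb bE]] pZ pge] := rp; have [_ _ vZ _] := cv.
have p'Z z : z \in h |: Z -> dot p' (a z) = 0.
  rewrite !inE => /predU1P[->|zZ]; rewrite shootE.
    by rewrite /ratio divfK // subrr.
  by rewrite pZ // vZ // mulr0 subr0.
split=> //.
- exists (pull_back v h b); split.
  + rewrite cardsU1 hZ /=; apply: (allpairs_f _ (x := (v, h))) => //.
    by apply: (allpairs_f pair); rewrite ?mem_enum.
  + move=> i; rewrite shootE ffunE dotBr dotZr -!pb /ratio; congr (_ - _).
    by field; exact: vh.
  + move=> i; rewrite ffunE; have [c ->] := bE i; have [d ->] := bE h.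
    set l := _ / _; exists (fun z => if z == h then - l else c z - l * d z).
    rewrite big_setU1 //= eqxx scalerDr opprD scaleNr -addrA.
    rewrite [\sum_(z in Z) c z *: a z + _]addrCA; congr (_ + (_ + _)).
    rewrite scaler_sumr -sumrN -big_split /=; apply: eq_bigr => z zZ.
    have /negbTE-> : z != h by apply: contraTneq zZ => ->.
    by rewrite scalerBl scalerA.
- move=> c; have [cZ|cZ] := boolP (co c \in h |: Z).
    by rewrite -dot_delta -aco p'Z.
  have cZ' : co c \notin Z by apply: contra cZ => cZ; rewrite inE cZ orbT.
  have := shoot_mul_ge0 (coS c); rewrite pmulr_lge0 ?aco ?dot_delta //.
  by rewrite lt_neqAle pge andbT eq_sym -dot_delta -aco (reach_neq0 gp0 rp).
Qed.

Hypothesis (vW : v \in min_norm_pts) (hZn : (#|h |: Z| < n)%N).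

Lemma shoot_mul_gt0 i : i \in S -> i \notin h |: Z -> 0 < dot p' (a i) * dot p (a i).
Proof.
move=> iS iZ; have iZ' : i \notin Z by apply: contra iZ => iZ; rewrite inE iZ orbT.
rewrite lt_neqAle shoot_mul_ge0 // andbT eq_sym mulf_neq0 //.
  exact: (reach_neq0 gp0 (reach_shoot vW)).
exact: (reach_neq0 gp0 rp).
Qed.

Lemma cell_shoot x : cell a S (h |: Z) (sgn p') x -> cell a S Z (sgn p) x.
Proof.
move=> [x0 x1 xZ xS]; split=> //.
  by move=> z zZ; apply: xZ; rewrite inE zZ orbT.
move=> i iS; have [iZ|iZ] := boolP (i \in h |: Z); first by rewrite xZ ?mulr0.
have := xS i iS; have pos := shoot_mul_gt0 iS iZ; rewrite !ffunE.
have := pos; case: (ltrP 0 (dot p' (a i))) => [p'0|p'0].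
  by rewrite pmulr_rgt0 // => ->.
by case: (ltrP 0 (dot p (a i))) => // pi; move=> pp; nra.
Qed.

(** Two functionals that vanish at the same time would both vanish at the end
    point, where genericity only allows those in [h |: Z]. *)
Lemma hit_unique i : blocking S Z v p i -> ratio v p i = ratio v p h -> i = h.
Proof.
move=> ci rE; apply/eqP; apply: contraT => ih.
have /andP[/setDP[iS iZ] vp0] := ci.
have vi : dot v (a i) != 0 by apply: contraTneq vp0 => ->; rewrite mul0r ltxx.
have iZ' : i \notin h |: Z by rewrite !inE negb_or ih.
have := reach_neq0 gp0 (reach_shoot vW) hZn iZ'.
by rewrite shootE -rE /ratio divfK // subrr eqxx.
Qed.

End Shot.

(** The vectors whose multiples are removed from [p] in turn; they generate a
    cone that contains [p].  This is the bottom-vertex triangulation of a cell,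
    with points of minimal norm instead of lowest vertices. *)
Fixpoint descent k S Z p : seq 'rV[R]_n :=
  if k is k'.+1 then
    let v := min_norm_pt a S Z (sgn p) in
    v :: (if hit S Z v p is Some h then descent k' S (h |: Z) (shoot v h p)
          else nseq k' 0)
  else [::].

(** The hyperplanes reached by the descent and the sides from which they are
    reached.  The last round takes place on a ray, where nothing is left to
    record. *)
Fixpoint itinerary k S Z p : seq (I * bool) :=
  if k is k'.+1 then
    if k' == 0 then [::] else
    let v := min_norm_pt a S Z (sgn p) in
    if hit S Z v p is Some h
    then (h, 0 < dot p (a h)) :: itinerary k' S (h |: Z) (shoot v h p)
    else [::]
  else [::].

(** The indices whose removal from [S] may change the descent. *)
Fixpoint defining k S Z p : {set I} :=
  if k is k'.+1 then
    let v := min_norm_pt a S Z (sgn p) in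
    critical a S Z (sgn p) :|:
    (if hit S Z v p is Some h
     then h |: defining k' S (h |: Z) (shoot v h p) else set0)
  else set0.

Lemma descentS k S Z p : descent k.+1 S Z p =
  min_norm_pt a S Z (sgn p) ::
    (if hit S Z (min_norm_pt a S Z (sgn p)) p is Some h
     then descent k S (h |: Z) (shoot (min_norm_pt a S Z (sgn p)) h p) else nseq k 0).
Proof. by []. Qed.

Lemma itineraryS k S Z p : itinerary k.+2 S Z p =
  if hit S Z (min_norm_pt a S Z (sgn p)) p is Some h
  then (h, 0 < dot p (a h)) ::
       itinerary k.+1 S (h |: Z) (shoot (min_norm_pt a S Z (sgn p)) h p)
  else [::].
Proof. by []. Qed.

Lemma size_descent k S Z p : size (descent k S Z p) = k.
Proof.
elim: k Z p => //= k IH Z p; case: hit => [h|]; first by rewrite IH.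
by rewrite size_nseq.
Qed.

Lemma min_norm_pt_mem S Z s : min_norm_pt a S Z s \in min_norm_pts.
Proof. by apply/mapP; exists ((S, Z), s); rewrite ?mem_enum. Qed.

Section Simplex.
Variables (p0 : 'rV[R]_n) (S : {set I}).
Hypotheses (gp0 : generic p0) (coS : forall c, co c \in S).

Lemma min_norm_pt_cell S' Z p : reach p0 Z p -> (#|Z| < n)%N ->
  cell a S' Z (sgn p) (min_norm_pt a S' Z (sgn p)).
Proof. by move=> rp Zn; have [] := min_norm_ptP (reach_cell gp0 S' rp Zn). Qed.

Lemma hit_card S' Z v p h : hit S' Z v p = Some h -> #|h |: Z| = #|Z|.+1.
Proof. by move=> /hitP[/andP[/setDP[_ hZ] _] _]; rewrite cardsU1 hZ. Qed.

Lemma descent_cell k Z p : reach p0 Z p -> (#|Z| + k = n)%N ->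
  forall v, v \in descent k S Z p -> cell a S Z (sgn p) v.
Proof.
elim: k Z p => //= k IH Z p rp Zk v.
have Zn : (#|Z| < n)%N by rewrite -Zk addnS ltnS leq_addr.
have cv := min_norm_pt_cell S rp Zn.
rewrite inE => /predU1P[->//|].
have [h hh] := hit_ex gp0 coS rp Zn cv; rewrite hh.
have rp' := reach_shoot gp0 coS rp Zn cv hh (min_norm_pt_mem _ _ _).
case: k IH Zk => [//|k] IH Zk vs.
have hZn : (#|h |: Z| < n)%N by rewrite (hit_card hh) -Zk addnS ltnS addnS ltnS leq_addr.
apply: (cell_shoot gp0 coS rp Zn cv hh (min_norm_pt_mem _ _ _) hZn).
by apply: IH vs => //; rewrite (hit_card hh) -Zk addSnnS.
Qed.

Lemma descent_cone k Z p : reach p0 Z p -> (#|Z| + k = n)%N ->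
  exists t : nat -> R, (forall l, 0 <= t l) /\
    p = \sum_(l < k) t l *: nth 0 (descent k S Z p) l.
Proof.
elim: k Z p => [|k IH] Z p rp Zk.
  exists (fun=> 0); split=> //; rewrite big_ord0.
  by have [_ pZ _] := rp; apply: indep_span pZ; rewrite -Zk addn0.
have Zn : (#|Z| < n)%N by rewrite -Zk addnS ltnS leq_addr.
have cv := min_norm_pt_cell S rp Zn => /=.
have [h hh] := hit_ex gp0 coS rp Zn cv; rewrite hh.
have rp' := reach_shoot gp0 coS rp Zn cv hh (min_norm_pt_mem _ _ _).
have [|t [t0 pE]] := IH _ _ rp'; first by rewrite (hit_card hh) -Zk addSnnS.
exists (fun l => if l is l'.+1 then t l' else ratio (min_norm_pt a S Z (sgn p)) p h).
split; first by case=> [|l] //=; exact/ltW/(ratio_gt0 hh).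
rewrite big_ord_recl /= -[X in _ + X]pE.
by rewrite /shoot addrC subrK.
Qed.

Lemma card_defining k Z p : reach p0 Z p -> (#|Z| + k = n)%N ->
  (#|defining k S Z p| <= k * n.+1)%N.
Proof.
elim: k Z p => [|k IH] Z p rp Zk /=; first by rewrite cards0.
have Zn : (#|Z| < n)%N by rewrite -Zk addnS ltnS leq_addr.
have cv := min_norm_pt_cell S rp Zn => /=.
have [h hh] := hit_ex gp0 coS rp Zn cv; rewrite hh.
have rp' := reach_shoot gp0 coS rp Zn cv hh (min_norm_pt_mem _ _ _).
have {IH}IH := IH _ _ rp'; rewrite (hit_card hh) addSnnS in IH.
rewrite mulSn addSnnS; apply: leq_trans (leq_card_setU _ _) _.
apply: leq_add; first exact: card_critical (reach_cell gp0 S rp Zn).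
by rewrite cardsU1 -add1n leq_add ?leq_b1 ?IH.
Qed.

(** Removing a constraint that is not critical leaves the point of minimal
    norm in place, and removing a functional that is not the first to vanish
    leaves the first one unchanged, as it is unique. *)
Lemma descent_setD1 j k Z p : reach p0 Z p -> (#|Z| + k = n)%N ->
  (forall c, co c != j) -> j \in S -> j \notin defining k S Z p ->
  descent k (S :\ j) Z p = descent k S Z p.
Proof.
move=> + + cj jS; elim: k Z p => [//|k IH] Z p rp Zk /=.
have Zn : (#|Z| < n)%N by rewrite -Zk addnS ltnS leq_addr.
have coS' c : co c \in S :\ j by rewrite !inE cj coS.
rewrite inE negb_or => /andP[]; rewrite inE jS negbK => /eqP vE.
have cv := min_norm_pt_cell S rp Zn; have cv' := min_norm_pt_cell (S :\ j) rp Zn.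
rewrite vE in cv' *; set v := min_norm_pt a S Z (sgn p) in cv cv' *.
have [h hh] := hit_ex gp0 coS rp Zn cv; rewrite hh.
have [h' hh'] := hit_ex gp0 coS' rp Zn cv'; rewrite hh'.
rewrite !inE negb_or => /andP[jh jd]; congr (_ :: _).
have rp' := reach_shoot gp0 coS rp Zn cv hh (min_norm_pt_mem _ _ _).
case: k IH Zk jd => [//|k] IH Zk jd.
have hZn : (#|h |: Z| < n)%N by rewrite (hit_card hh) -Zk addnS ltnS addnS ltnS leq_addr.
have candS i : blocking (S :\ j) Z v p i -> blocking S Z v p i.
  by rewrite /blocking !inE => /andP[/andP[-> /andP[_ ->]] ->].
have [c' m'] := hitP hh'; have [c m] := hitP hh.
have e : h' = h.
  apply: (hit_unique gp0 coS rp Zn cv hh (min_norm_pt_mem _ _ _) hZn); first exact: candS.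
  apply/eqP; rewrite eq_le m ?candS // m' //.
  by move: c; rewrite /blocking !inE eq_sym jh.
by rewrite e IH // (hit_card hh) -Zk addSnnS.
Qed.

Lemma size_itinerary k Z p : reach p0 Z p -> (#|Z| + k = n)%N ->
  size (itinerary k S Z p) = k.-1 /\ {subset [seq e.1 | e <- itinerary k S Z p] <= S}.
Proof.
elim: k Z p => [|k IH] Z p rp Zk //=.
have Zn : (#|Z| < n)%N by rewrite -Zk addnS ltnS leq_addr.
have cv := min_norm_pt_cell S rp Zn => /=.
have [h hh] := hit_ex gp0 coS rp Zn cv; rewrite hh.
have rp' := reach_shoot gp0 coS rp Zn cv hh (min_norm_pt_mem _ _ _).
have {IH}IH := IH _ _ rp'; rewrite (hit_card hh) addSnnS in IH.
case: k IH Zk => [//|k] /= IH Zk; have [-> sub] := IH Zk; split=> // i.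
by rewrite inE => /predU1P[->|/sub //]; exact: hit_inS hh.
Qed.

End Simplex.

(** Equal signs on [S] mean equal cells. *)
Lemma min_norm_pt_signs p0 q0 S Z p q : generic p0 -> generic q0 ->
  reach p0 Z p -> reach q0 Z q -> (#|Z| < n)%N ->
  (forall i, i \in S -> i \notin Z -> 0 < dot p (a i) * dot q (a i)) ->
  min_norm_pt a S Z (sgn p) = min_norm_pt a S Z (sgn q).
Proof.
move=> gp0 gq0 rp rq Zn signs.
have agree (P Q y : R) : 0 < P * Q -> 0 <= y * P -> 0 <= y * Q.
  move=> PQ yP; have P0 : P != 0 by apply: contraTneq PQ => ->; rewrite mul0r ltxx.
  have : 0 <= y * P * (P * Q) by rewrite mulr_ge0 // ltW.
  have -> : y * P * (P * Q) = y * Q * P ^+ 2 by ring.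
  by rewrite pmulr_lge0 // lt_neqAle sqr_ge0 andbT eq_sym sqrf_eq0.
apply: eq_min_norm_pt => x; split=> -[x0 x1 xZ xS]; split=> // i iS;
  (have [iZ|iZ] := boolP (i \in Z); first by rewrite xZ ?mulr0);
  move: (xS i iS);
  rewrite (sign_of_ge0 _ (reach_neq0 gp0 rp Zn iZ)) (sign_of_ge0 _ (reach_neq0 gq0 rq Zn iZ)).
  exact/agree/signs.
by apply: agree; rewrite mulrC signs.
Qed.

(** From the last round backwards.  On a ray two points are proportional and so
    have the same signs.  If the signs agree after a projection, they agree
    before it: the projection onto [h] preserves the signs of the other
    functionals, and that of [h] is recorded.  Equal signs give equal cells and
    hence equal points of minimal norm. *)
Lemma itinerary_descent p0 q0 S k Z p q : generic p0 -> generic q0 ->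
  (forall c, co c \in S) -> reach p0 Z p -> reach q0 Z q ->
  (#|Z| + k.+1 = n)%N -> itinerary k.+1 S Z p = itinerary k.+1 S Z q ->
  (forall i, i \in S -> i \notin Z -> 0 < dot p (a i) * dot q (a i)) /\
  descent k.+1 S Z p = descent k.+1 S Z q.
Proof.
move=> gp0 gq0 coS; elim: k Z p q => [|k IH] Z p q rp rq Zk.
  have Zn : (#|Z| < n)%N by rewrite -Zk addn1.
  move=> _.
  have signs i : i \in S -> i \notin Z -> 0 < dot p (a i) * dot q (a i).
    move=> iS iZ; have [c cZ] := free_coord Zn.
    have pos r0 r : generic r0 -> reach r0 Z r -> 0 < dot r (a (co c)).
      move=> gr0 rr; rewrite lt_neqAle eq_sym (reach_neq0 gr0 rr) //=.
      by rewrite aco dot_delta; have [_ _ ->] := rr.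
    have pc := pos _ _ gp0 rp; have qc := pos _ _ gq0 rq.
    have : dot q (a (co c)) *: p - dot p (a (co c)) *: q = 0.
      apply: (@indep_span (co c |: Z)); first by rewrite cardsU1 cZ -Zk addnC.
      move=> z; rewrite !inE dotBl !dotZl => /predU1P[->|zZ].
        by rewrite mulrC subrr.
      have [_ pZ _] := rp; have [_ qZ _] := rq.
      by rewrite (pZ z zZ) (qZ z zZ) !mulr0 subrr.
    move=> /(congr1 (fun x => dot x (a i))); rewrite dotBl !dotZl dot0l.
    move=> /eqP; rewrite subr_eq0 => /eqP e.
    have qi := reach_neq0 gq0 rq Zn iZ.
    have {qi}: 0 < dot q (a i) ^+ 2 by rewrite lt_neqAle sqr_ge0 andbT eq_sym sqrf_eq0.
    by move=> q2; rewrite -(pmulr_rgt0 _ qc) mulrA e -mulrA -expr2 mulr_gt0.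
  split=> //=; congr (_ :: _); last by case: hit => [?|]; case: hit.
  exact: (min_norm_pt_signs gp0 gq0).
rewrite [descent _ S Z p]descentS [descent _ S Z q]descentS.
rewrite [itinerary _ S Z p]itineraryS [itinerary _ S Z q]itineraryS.
have Zn : (#|Z| < n)%N by rewrite -Zk addnS ltnS leq_addr.
have cp := min_norm_pt_cell gp0 S rp Zn; have cq := min_norm_pt_cell gq0 S rq Zn.
have [h hh] := hit_ex gp0 coS rp Zn cp; rewrite hh.
have [h' hh'] := hit_ex gq0 coS rq Zn cq; rewrite hh'.
have rp' := reach_shoot gp0 coS rp Zn cp hh (min_norm_pt_mem _ _ _).
have rq' := reach_shoot gq0 coS rq Zn cq hh' (min_norm_pt_mem _ _ _).
move=> /eqP; rewrite eqseq_cons xpair_eqE => /andP[/andP[/eqP hE /eqP eh] /eqP ce].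
rewrite -hE in hh' rq' eh ce *.
have hZn : (#|h |: Z| < n)%N.
  by rewrite (hit_card hh) -Zk addnS ltnS addnS ltnS leq_addr.
have hZ := hit_notinZ hh.
have [|sg' ->] := IH _ _ _ rp' rq' _ ce; first by rewrite (hit_card hh) -Zk addSnnS.
have signs i : i \in S -> i \notin Z -> 0 < dot p (a i) * dot q (a i).
  move=> iS iZ; have [->|ih] := eqVneq i h.
    exact: same_sign (reach_neq0 gp0 rp Zn hZ) (reach_neq0 gq0 rq Zn hZ) eh.
  have iZ' : i \notin h |: Z by rewrite !inE negb_or ih.
  apply: mul_gt0_shift (sg' i iS iZ').
    exact: (shoot_mul_gt0 gp0 coS rp Zn cp hh (min_norm_pt_mem _ _ _) hZn iS iZ').
  exact: (shoot_mul_gt0 gq0 coS rq Zn cq hh' (min_norm_pt_mem _ _ _) hZn iS iZ').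
split; first exact: signs.
by rewrite (min_norm_pt_signs gp0 gq0 rp rq Zn signs).
Qed.

Lemma itinerary_descent_gt0 p0 q0 S k Z p q : generic p0 -> generic q0 ->
  (forall c, co c \in S) -> reach p0 Z p -> reach q0 Z q -> (0 < k)%N ->
  (#|Z| + k = n)%N -> itinerary k S Z p = itinerary k S Z q ->
  descent k S Z p = descent k S Z q.
Proof.
move=> gp0 gq0 coS rp rq; case: k => // k _ Zk cE.
by have [] := itinerary_descent gp0 gq0 coS rp rq Zk cE.
Qed.

End Descent.

(** * General position *)

(** Fewer than [n] vectors lie in a hyperplane. *)
Lemma normal_exists (R : realType) (n : nat) (T : finType) (Z : {set T})
    (x : T -> 'rV[R]_n) : (#|Z| < n)%N ->
  exists2 l : 'rV[R]_n, l != 0 & forall z, z \in Z -> dot (x z) l = 0.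
Proof.
move=> Zn; pose M := \matrix_(i < n, k < #|Z|) x (enum_val k) 0 i.
have [k uk] : exists k, row k (kermx M) != 0.
  apply/existsP; apply: contraLR Zn => /existsPn k0; rewrite -leqNgt.
  have /eqP : kermx M = 0.
    by apply/row_matrixP => k; rewrite row0; apply/eqP; rewrite -[_ == _]negbK k0.
  rewrite -mxrank_eq0 mxrank_ker subn_eq0 => h; apply: leq_trans h _.
  exact: rank_leq_col.
exists (row k (kermx M)) => // z zZ; rewrite dotC.
have /matrixP/(_ 0 (enum_rank_in zZ z)) : row k (kermx M) *m M = 0.
  by rewrite -row_mul mulmx_ker row0.
rewrite !mxE => h; rewrite -[RHS]h; apply: eq_bigr => i _.
by rewrite !mxE enum_rankK_in.
Qed.

Section GeneralPosition.
Variables (R : realType) (n : nat) (J : finType).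
Implicit Types (g : J -> 'rV[R]_n).

Definition withcoord g (i : J + 'I_n) : 'rV[R]_n :=
  match i with inl j => g j | inr c => delta_mx 0 c end.

(** The functionals are moved one at a time, each away from all hyperplanes
    spanned by others.  The conditions [C j] are affine so that they can
    confine [g' j] to a small box. *)
Lemma general_position g (C : J -> seq ('rV[R]_n * R)) :
  (forall j c, c \in C j -> 0 < dot (g j) c.1 + c.2) ->
  exists g', (forall j c, c \in C j -> 0 < dot (g' j) c.1 + c.2) /\
    forall (Z : {set J + 'I_n}) (c : J + 'I_n -> R), (#|Z| <= n)%N ->
      \sum_(z in Z) c z *: withcoord g' z = 0 -> forall z, z \in Z -> c z = 0.
Proof.
move=> gC.
suff /(_ (enum J))[g' [g'C ind]] : forall r : seq J,
    exists g', (forall j c, c \in C j -> 0 < dot (g' j) c.1 + c.2) /\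
    forall (Z : {set J + 'I_n}) (c : J + 'I_n -> R), (#|Z| <= n)%N ->
      (forall j, inl j \in Z -> j \in r) ->
      \sum_(z in Z) c z *: withcoord g' z = 0 -> forall z, z \in Z -> c z = 0.
  exists g'; split=> // Z c Zn; apply: ind => // j _.
  by rewrite mem_enum.
elim=> [|j r [g' [g'C ind]]].
  exists g; split=> // Z c Zn Zr Z0 [j /Zr //|i iZ].
  move/(congr1 (fun x : 'rV[R]_n => x 0 i)): Z0; rewrite summxE mxE (bigD1 _ iZ) /=.
  rewrite !mxE !eqxx mulr1 big1 ?addr0 // => -[k|k] /andP[kZ ki].
    by have := Zr _ kZ.
  rewrite !mxE (_ : (i == k) = false) ?andbF ?mulr0 //.
  by apply: contraNF ki => /eqP ->.
(* A repeated index has already been moved. *)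
have [jr|jr] := boolP (j \in r).
  exists g'; split=> // Z c Zn Zr; apply: ind => // k /Zr.
  by rewrite inE => /predU1P[->|].
pose nu (Z : {set J + 'I_n}) : 'rV[R]_n :=
  if boolp.pselect (exists2 l : 'rV[R]_n, l != 0 &
       forall z, z \in Z -> dot (withcoord g' z) l = 0) is left h
  then s2val (boolp.cid2 h) else 0.
have nuP (Z : {set J + 'I_n}) : (#|Z| < n)%N ->
    nu Z != 0 /\ forall z, z \in Z -> dot (withcoord g' z) (nu Z) = 0.
  move=> Zn; rewrite /nu; case: boolp.pselect => [h|[]].
    by split; [exact: (s2valP (boolp.cid2 h)) | exact: (s2valP' (boolp.cid2 h))].
  exact: normal_exists.
pose nus := [seq nu Z | Z : {set J + 'I_n} <-
  [seq Z : {set J + 'I_n} <- enum {: {set J + 'I_n}} | (#|Z| < n)%N]].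
have [|y [yL yC]] := @perturb R n (g' j) nus (C j) _ (g'C j).
  by move=> l /mapP[Z]; rewrite mem_filter => /andP[Zn _] ->; have [] := nuP Z Zn.
pose g2 k := if k == j then y else g' k.
exists g2; split.
  by move=> k c; rewrite /g2; case: eqP => [-> /yC|_ /g'C].
have g2E z : z != inl j -> withcoord g2 z = withcoord g' z.
  case: z => //= k kj; rewrite /g2; have /negbTE-> // : k != j.
  by apply: contra kj => /eqP->.
move=> Z c Zn Zr Z0.
pose Z1 := Z :\ inl j.
have Z1E z : z \in Z1 -> withcoord g2 z = withcoord g' z.
  by rewrite !inE => /andP[zj _]; exact: g2E.
(* The normal of the span of the other functionals detects the coefficient of j. *)
have cj : inl j \in Z -> c (inl j) = 0.
  move=> jZ; have Z1n : (#|Z1| < n)%N by move: Zn; rewrite (cardsD1 (inl j)) jZ.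
  have [_ nuZ] := nuP _ Z1n.
  have := congr1 (fun x => dot x (nu Z1)) Z0; rewrite (big_setD1 _ jZ) /= dot0l.
  rewrite dotDl dotZl dot_suml big1 ?addr0 => [|z zZ].
    rewrite /g2 eqxx => /eqP; rewrite mulf_eq0 => /orP[/eqP //|yn].
    have /yL : nu Z1 \in nus.
      by apply/mapP; exists Z1 => //; rewrite mem_filter Z1n mem_enum.
    by rewrite yn.
  by rewrite dotZl Z1E // nuZ // mulr0.
have Z1n : (#|Z1| <= n)%N by apply: leq_trans Zn; apply/subset_leq_card/subD1set.
have Z1r k : inl k \in Z1 -> k \in r.
  rewrite !inE => /andP[kj /Zr]; rewrite inE => /predU1P[e|//].
  by rewrite e eqxx in kj.
have Z10 : \sum_(z in Z1) c z *: withcoord g' z = 0.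
  rewrite -[RHS]Z0; have [jZ|jZ] := boolP (inl j \in Z).
    rewrite [RHS](big_setD1 _ jZ) /= cj // scale0r add0r.
    by apply: eq_bigr => z /Z1E ->.
  have -> : Z1 = Z.
    by apply/setP => z; rewrite !inE; case: eqP => [->|]; rewrite ?(negbTE jZ).
  by apply: eq_bigr => z zZ; rewrite g2E //; apply: contraNneq jZ => <-.
move=> z zZ; have [zj|zj] := eqVneq z (inl j); first by rewrite zj cj // -zj.
by apply: (ind Z1) => //; rewrite !inE zj.
Qed.
End GeneralPosition.

Lemma generic_exists (R : realType) (n : nat) (I : finType) (a : I -> 'rV[R]_n)
    (p : 'rV[R]_n) (C : seq 'rV[R]_n) :
  (forall i, 0 < p 0 i) -> (forall c, c \in C -> 0 < dot p c) ->
  exists p', generic a p' /\ forall c, c \in C -> 0 < dot p' c.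
Proof.
move=> p0 pC.
pose app (b : {ffun I -> 'rV[R]_n}) i := b i.
pose L := flatten [seq allpairs app (pull_backs a j) (enum I) | j <- iota 0 n].
pose C' := [seq (c, 0 : R) | c <- C ++ [seq delta_mx 0 i | i <- enum 'I_n]].
have [||p' [p'L p'C]] := @perturb R n p [seq l <- L | l != 0] C'.
- by move=> l; rewrite mem_filter => /andP[].
- move=> _ /mapP[c + ->] /=; rewrite addr0 mem_cat => /orP[/pC //|].
  by move=> /mapP[i _ ->]; rewrite dot_delta.
have p'C1 c : c \in C ++ [seq delta_mx 0 i | i <- enum 'I_n] -> 0 < dot p' c.
  move=> cC; have /p'C : (c, 0) \in C' by apply/mapP; exists c.
  by rewrite addr0.
exists p'; split; last by move=> c cC; apply: p'C1; rewrite mem_cat cC.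
split.
  move=> i; rewrite -dot_delta; apply: p'C1; rewrite mem_cat; apply/orP; right.
  by apply/mapP; exists i; rewrite ?mem_enum.
move=> j jn b bf i bi; apply: p'L; rewrite mem_filter bi /=.
apply/flattenP; exists (allpairs app (pull_backs a j) (enum I)).
  by apply/mapP; exists j; rewrite ?mem_iota.
by apply/allpairsP; exists (b, i); rewrite mem_enum.
Qed.

(** * Random samples *)
(** Adding [j] to [S] identifies the pairs with [j] outside [S] with the pairs
    of a larger set and one of its elements. *)
Lemma sum_cards_swap (T : finType) (s : nat) (F : {set T} -> T -> nat) :
  (\sum_(S : {set T} | #|S| == s) \sum_(j | j \notin S) F S j =
   \sum_(S : {set T} | #|S| == s.+1) \sum_(j in S) F (S :\ j) j)%N.
Proof.
rewrite !pair_big_dep /=.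
rewrite (reindex_onto (fun u : {set T} * T => (u.1 :\ u.2, u.2))
                      (fun u => (u.2 |: u.1, u.2))) /=.
  apply: eq_bigl => -[S j] /=; rewrite !inE eqxx /= andbT.
  have [jS|jS] := boolP (j \in S).
    by rewrite setD1K // eqxx andbT (cardsD1 j S) jS andbT add1n eqSS.
  rewrite andbF; apply/negbTE; apply: contraNN jS => /andP[_ /eqP[<-]].
  by rewrite setU11.
by move=> [S j] /= /andP[_ jS]; rewrite setU1K.
Qed.

Section Sampling.
Variables (R : realType) (n : nat) (J X : finType).
Variables (g : J -> 'rV[R]_n) (p : X -> 'rV[R]_n).
Let a := withcoord g.
Hypothesis n0 : (0 < n)%N.
Hypothesis indep : forall (Z : {set J + 'I_n}) (c : J + 'I_n -> R), (#|Z| <= n)%N ->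
  \sum_(z in Z) c z *: a z = 0 -> forall z, z \in Z -> c z = 0.
Hypothesis gp : forall x, generic a (p x).
Implicit Types (S : {set J}) (x : X) (j : J).

Definition sample S : {set J + 'I_n} := inl @: S :|: inr @: [set: 'I_n].

Definition simplex S x := descent a n (sample S) set0 (p x).

Let aco (c : 'I_n) : a (inr c) = delta_mx 0 c. Proof. by []. Qed.

Let coS S (c : 'I_n) : inr c \in sample S.
Proof. by rewrite inE; apply/orP; right; apply: imset_f. Qed.

Let rp x : reach a (p x) set0 (p x). Proof. exact: reach0. Qed.

Let card0n : (#|(set0 : {set J + 'I_n})| + n = n)%N.
Proof. by rewrite cards0. Qed.

Let inl_inj : injective (inl : J -> J + 'I_n). Proof. by move=> j k []. Qed.

Lemma mem_sample S j : (inl j \in sample S) = (j \in S).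
Proof.
rewrite inE mem_imset //; case: (j \in S) => //=.
by apply/negbTE/negP => /imsetP[].
Qed.

Lemma card_sample S : #|sample S| = (#|S| + n)%N.
Proof.
have inr_inj : injective (inr : 'I_n -> J + 'I_n) by move=> j k [].
rewrite cardsU disjoint_setI0.
  by rewrite cards0 subn0 !card_imset // cardsT card_ord.
rewrite -setI_eq0; apply/eqP/setP => z; rewrite !inE; apply/negbTE/negP.
by move=> /andP[/imsetP[j _ ->] /imsetP[]].
Qed.

Lemma sample_setD1 S j : sample (S :\ j) = sample S :\ inl j.
Proof.
apply/setP => -[k|c]; first by rewrite mem_sample !in_setD1 mem_sample.
by rewrite in_setD1 !coS.
Qed.

(** A weak sign on the vectors of the descent extends to the cone they span,
    hence to every point with the same descent. *)
Definition uncrossed S x j :=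
  all (fun v => 0 <= dot v (g j)) (simplex S x) ||
  all (fun v => dot v (g j) <= 0) (simplex S x).

Lemma uncrossed_in S x j : j \in S -> uncrossed S x j.
Proof.
move=> jS.
have cS v : v \in simplex S x -> cell a (sample S) set0 (sgn a (p x)) v.
  exact: (descent_cell aco indep (gp x) (coS S) (rp x) card0n).
have jp : dot (p x) (a (inl j)) != 0.
  by rewrite (reach_neq0 indep (gp x) (rp x)) ?cards0 // inE.
have vj v : v \in simplex S x -> 0 <= dot v (a (inl j)) * dot (p x) (a (inl j)).
  have jS' : inl j \in sample S by rewrite mem_sample.
  by move=> /cS[_ _ _ /(_ _ jS')]; rewrite sign_of_ge0.
apply/orP; case: (ltgtP (dot (p x) (a (inl j))) 0) jp => // pj _; [right|left].
  by apply/allP => v /vj; rewrite nmulr_lge0.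
by apply/allP => v /vj; rewrite pmulr_lge0.
Qed.

(** If [j] does not define the descent for [S], the descent is the same
    without [j]; but the vectors of the former lie on one side of [j]. *)
Lemma crossed_defining S x j : j \in S -> ~~ uncrossed (S :\ j) x j ->
  inl j \in defining a n (sample S) set0 (p x).
Proof.
move=> jS; apply: contraR => jd.
have := uncrossed_in x jS; rewrite /uncrossed /simplex sample_setD1.
rewrite (descent_setD1 aco indep (gp x) (coS S) (rp x) card0n) //.
by rewrite mem_sample.
Qed.

(** Backward analysis: a pair of a sample of size [s] and a functional outside
    it is a sample of size [s + 1] with a distinguished element, which in a
    crossed pair must be one of the few that define the descent. *)
Lemma sum_crossed s x :
  (\sum_(S : {set J} | #|S| == s) #|[set j | ~~ uncrossed S x j]|
   <= 'C(#|J|, s.+1) * (n * n.+1))%N.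
Proof.
have e S : #|[set j | ~~ uncrossed S x j]| =
    (\sum_(j | j \notin S) ~~ uncrossed S x j)%N.
  rewrite -sum1_card (bigID (mem S)) /= big1 ?add0n => [|j /andP[]]; last first.
    by rewrite inE => + jS; rewrite uncrossed_in.
  by rewrite [RHS]big_mkcond [LHS]big_mkcond; apply: eq_bigr => j _;
    rewrite inE andbC; case: (j \in S); case: uncrossed.
under eq_bigr do rewrite e.
rewrite (sum_cards_swap s (fun S j => ~~ uncrossed S x j : nat)).
have -> : ('C(#|J|, s.+1) * (n * n.+1) =
    \sum_(S : {set J} | #|S| == s.+1) n * n.+1)%N.
  rewrite sum_nat_const -card_draws; congr (_ * _)%N.
  by apply: eq_card => S; rewrite !inE.
apply: leq_sum => S _.
apply: leq_trans (card_defining (S := sample S) aco indep (gp x) (coS S) (rp x) card0n).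
have -> : (\sum_(j in S) ~~ uncrossed (S :\ j) x j =
    #|[set j in S | ~~ uncrossed (S :\ j) x j]|)%N.
  rewrite -sum1_card big_mkcond [RHS]big_mkcond; apply: eq_bigr => j _.
  by rewrite inE; case: (j \in S); case: uncrossed.
rewrite -(card_imset _ inl_inj); apply/subset_leq_card/fintype.subsetP => z.
by move=> /imsetP[j + ->{z}]; rewrite inE => /andP[]; exact: crossed_defining.
Qed.

Lemma good_sample s : exists S, (#|S| <= s)%N /\
  ((\sum_x #|[set j | ~~ uncrossed S x j]|) * s.+1 <= #|X| * (n * n.+1) * #|J|)%N.
Proof.
(* If there are too few functionals to sample, all are taken and none is crossed. *)
have [Js|sJ] := ltnP #|J| s.
  exists [set: J]; rewrite cardsT ltnW // big1 ?mul0n // => x _.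
  by apply: eq_card0 => j; rewrite !inE uncrossed_in // inE.
pose f (S : {set J}) := (\sum_x #|[set j | ~~ uncrossed S x j]|)%N.
have tot : (\sum_(S : {set J} | #|S| == s) f S <=
    'C(#|J|, s.+1) * (#|X| * (n * n.+1)))%N.
  rewrite exchange_big /= mulnCA -sum_nat_const.
  by apply: leq_sum => x _; exact: sum_crossed.
suff [S /eqP Ss fS] : exists2 S : {set J}, #|S| == s &
    (f S * s.+1 <= #|X| * (n * n.+1) * #|J|)%N by exists S; rewrite Ss.
have [[S Ss fS]|nS] := boolp.pselect (exists2 S : {set J}, #|S| == s &
    (f S * s.+1 <= #|X| * (n * n.+1) * #|J|)%N); first by exists S.
have big S : #|S| == s -> (#|X| * (n * n.+1) * #|J| < f S * s.+1)%N.
  by move=> Ss; rewrite ltnNge; apply/negP => fS; apply: nS; exists S.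
have C0 : (0 < 'C(#|J|, s))%N by rewrite bin_gt0.
have cardC : (\sum_(S : {set J} | #|S| == s) 1 = 'C(#|J|, s))%N.
  by rewrite sum1_card -card_draws; apply: eq_card => S; rewrite !inE.
have : ('C(#|J|, s) * (#|X| * (n * n.+1) * #|J|) <
        'C(#|J|, s) * (#|J| - s) * (#|X| * (n * n.+1)))%N.
  apply: (@leq_trans ((\sum_(S : {set J} | #|S| == s) f S) * s.+1)); last first.
    apply: leq_trans (leq_mul tot (leqnn _)) _.
    rewrite mulnAC leq_mul // mulnC mul_bin_left mulnC //.
  have [S0 S0s] : exists S0 : {set J}, #|S0| == s.
    apply/existsP; apply: contraTT C0 => /existsPn nS0.
    by rewrite -cardC big1 // => S /idPn; rewrite nS0.
  rewrite -cardC big_distrl /= big_distrl /= (bigD1 S0) //= [X in (_ <= X)%N](bigD1 S0) //=.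
  rewrite -addSn; apply: leq_add; first by rewrite mul1n big.
  by apply: leq_sum => S /andP[Ss _]; rewrite mul1n ltnW ?big.
rewrite -[X in (_ < X)%N]mulnA ltn_pmul2l // [X in (_ < X)%N]mulnC.
rewrite ltnNge => /negP; case.
by rewrite leq_mul2l leq_subr orbT.
Qed.

(** An itinerary has [n - 1] entries, each one of [#|S| + n] hyperplanes with
    one of its two sides. *)
Lemma size_simplices S : (size (undup [seq simplex S x | x <- enum X]) <=
  (2 * (#|S| + n)) ^ n.-1)%N.
Proof.
have e0 : (J + 'I_n) * bool := (inr (Ordinal n0), true).
pose cd x := itinerary a n (sample S) set0 (p x).
pose F (c : seq ((J + 'I_n) * bool)) : {ffun 'I_n.-1 -> (J + 'I_n) * bool} :=
  [ffun l : 'I_n.-1 => nth e0 c l].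
pose T := [set F (cd x) | x : X].
have cdP x : size (cd x) = n.-1 /\ {subset [seq e.1 | e <- cd x] <= sample S}.
  exact: (size_itinerary aco indep (gp x) (coS S) (rp x) card0n).
have FS x y : F (cd x) = F (cd y) -> simplex S x = simplex S y.
  move=> Fxy; have cxy : cd x = cd y.
    apply: (@eq_from_nth _ e0); first by rewrite !(cdP _).1.
    by move=> l; rewrite (cdP x).1 => ln; have /ffunP/(_ (Ordinal ln)) := Fxy; rewrite !ffunE.
  exact: (itinerary_descent_gt0 aco indep (gp x) (gp y) (coS S) (rp x) (rp y) n0 card0n cxy).
pose G c := if [pick x | F (cd x) == c] is Some x then simplex S x else [::].
have sub : {subset undup [seq simplex S x | x <- enum X] <= [seq G c | c <- enum T]}.
  move=> w; rewrite mem_undup => /mapP[x _ ->]; apply/mapP; exists (F (cd x)).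
    by rewrite mem_enum; apply/imsetP; exists x.
  rewrite /G; case: pickP => [y /eqP/FS //|/(_ x)]; by rewrite eqxx.
apply: leq_trans (uniq_leq_size (undup_uniq _) sub) _.
rewrite size_map -cardE.
have -> : ((2 * (#|S| + n)) ^ n.-1 =
    #|ffun_on (mem (setX (sample S) [set: bool])) : pred {ffun 'I_n.-1 -> _}|)%N.
  by rewrite card_ffun_on card_ord cardsX card_sample cardsT card_bool mulnC.
apply/subset_leq_card/fintype.subsetP => f /imsetP[x _ ->{f}].
apply/ffun_onP => l; rewrite ffunE.
have : nth e0 (cd x) l \in cd x by rewrite mem_nth // (cdP x).1.
by move=> lc; rewrite inE in_setT andbT; apply: (cdP x).2; apply: map_f.
Qed.

End Sampling.

(** * Cuttings *)

Lemma dot_simplex_bound (R : realType) (n : nat) (v y : 'rV[R]_n) (e : R) :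
  (forall i, 0 <= v 0 i) -> \sum_i v 0 i = 1 -> (forall i, `|y 0 i| <= e) ->
  `|dot v y| <= e.
Proof.
move=> v0 v1 ye; apply: le_trans (ler_norm_sum _ _ _) _.
rewrite -[leRHS]mul1r -v1 mulr_suml; apply: ler_sum => i _.
by rewrite normrM ger0_norm // ler_wpM2l.
Qed.

Definition above (R : realType) (n : nat) (w : seq 'rV[R]_n) (b : R) h :=
  all (fun v => b <= dot v h) w.
Definition below (R : realType) (n : nat) (w : seq 'rV[R]_n) (b : R) h :=
  all (fun v => dot v h <= b) w.

(** The points and functionals are perturbed into general position and the
    results on samples applied to the perturbed data; the thresholds [lo] and
    [hi] make the conclusion refer to the original ones.  They separate the
    negative values [dot (u x) (h j)], which are less than [- y], from the
    nonnegative ones, and the perturbed functional [g j] is so close to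
    [h j - mid], with [mid] between [lo] and [hi], that a weak sign of [g j] at
    a vector of the simplex puts [h j] on the right side of [lo] or [hi]. *)
Lemma cutting_pos (R : realType) (n : nat) (X J : finType) (u : X -> 'rV[R]_n)
    (h : J -> 'rV[R]_n) (s : nat) : (0 < n)%N ->
  (forall x i, 0 < u x 0 i) -> (forall x, \sum_i u x 0 i = 1) ->
  exists (w : X -> seq 'rV[R]_n) (lo hi : R),
    [/\ forall x, size (w x) = n,
        forall x j, above (w x) lo (h j) -> 0 <= dot (u x) (h j),
        forall x j, below (w x) hi (h j) -> dot (u x) (h j) < 0,
        (size (undup [seq w x | x <- enum X]) <= (2 * (s + n)) ^ n.-1)%N
      & ((\sum_x #|[set j | ~~ above (w x) lo (h j) & ~~ below (w x) hi (h j)]|)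
          * s.+1 <= #|X| * (n * n.+1) * #|J|)%N].
Proof.
move=> n0 u0 u1.
have [|y y0 yneg] := @pos_lower_bound R
    [seq - dot (u e.1) (h e.2) | e <- enum {: X * J} & dot (u e.1) (h e.2) < 0].
  by move=> z /mapP[e]; rewrite mem_filter => /andP[+ _] ->; rewrite oppr_gt0.
have {}yneg x j : dot (u x) (h j) < 0 -> dot (u x) (h j) < - y.
  move=> neg; rewrite ltrNr; apply: yneg; apply/mapP; exists (x, j) => //.
  by rewrite mem_filter neg mem_enum.
pose mid := - (y / 2); pose eta := y / 6.
pose lo := mid - eta; pose hi := mid + eta.
have eta0 : 0 < eta by rewrite divr_gt0.
have lohi : [/\ - y < lo, lo < hi & hi < 0] by rewrite /lo /hi /mid /eta; split; lra.
pose g0 j := h j - const_mx mid.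
pose C j : seq ('rV[R]_n * R) :=
  [seq (delta_mx 0 c, - g0 j 0 c + eta) | c <- enum 'I_n] ++
  [seq (- delta_mx 0 c, g0 j 0 c + eta) | c <- enum 'I_n].
have [|g [gC indep]] := @general_position R n J g0 C.
  move=> j c; rewrite mem_cat => /orP[]/mapP[i _ ->] /=; rewrite ?dotNr dot_delta; lra.
have gg0 j i : `|(g j - g0 j) 0 i| <= eta.
  rewrite mxE [(- g0 j) _ _]mxE ler_norml.
  have /gC : (delta_mx 0 i, - g0 j 0 i + eta) \in C j.
    by rewrite mem_cat; apply/orP; left; apply/mapP; exists i; rewrite ?mem_enum.
  have /gC : (- delta_mx 0 i, g0 j 0 i + eta) \in C j.
    by rewrite mem_cat; apply/orP; right; apply/mapP; exists i; rewrite ?mem_enum.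
  rewrite /= dotNr dot_delta; lra.
pose D x := [seq (if dot (u x) (h j) < 0 then const_mx lo - h j
                  else h j - const_mx hi) | j <- enum J].
have Dp x : exists p, generic (withcoord g) p /\ forall c, c \in D x -> 0 < dot p c.
  apply: generic_exists => // c /mapP[j _ ->]; have [yl lh hi0] := lohi.
  case: (ltrP (dot (u x) (h j)) 0) => [/yneg|] hj; rewrite dotBr dot_const u1; lra.
have [p pP] := boolp.choice Dp.
have gp x := (pP x).1.
have [S [Ss Scount]] := good_sample n0 indep gp s.
have aco (c : 'I_n) : withcoord g (inr c) = delta_mx 0 c by [].
have coS (c : 'I_n) : inr c \in sample n S.
  by rewrite inE; apply/orP; right; apply: imset_f.
have rp x := reach0 (gp x).
have card0n : (#|(set0 : {set J + 'I_n})| + n = n)%N by rewrite cards0.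
have cellw x v : v \in simplex g p S x -> (forall i, 0 <= v 0 i) /\ \sum_i v 0 i = 1.
  by move=> /(descent_cell aco indep (gp x) coS (rp x) card0n)[].
have near x v j : v \in simplex g p S x ->
    `|dot v (h j) - (dot v (g j) + mid)| <= eta.
  move=> /cellw[v0 v1]; have := dot_simplex_bound v0 v1 (gg0 j).
  rewrite -normrN /g0 !dotBr dot_const v1 mulr1.
  by congr (`|_| <= _); ring.
have cone x : exists t : nat -> R, (forall l, 0 <= t l) /\
    p x = \sum_(l < n) t l *: nth 0 (simplex g p S x) l.
  exact: (descent_cone aco indep (gp x) coS (rp x) card0n).
have sz x : size (simplex g p S x) = n by exact: size_descent.
exists (simplex g p S), lo, hi; split=> //.
- move=> x j /allP ab; rewrite leNgt; apply/negP => neg.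
  have /(pP x).2 : const_mx lo - h j \in D x.
    by apply/mapP; exists j; rewrite ?mem_enum ?neg.
  have [t [t0 ->]] := cone x; rewrite dot_suml; apply/negP; rewrite -leNgt.
  apply: sumr_le0 => l _; have wl : nth 0 (simplex g p S x) l \in simplex g p S x.
    by rewrite mem_nth ?sz.
  rewrite dotZl mulr_ge0_le0 // dotBr dot_const (cellw _ _ wl).2 mulr1 subr_le0.
  exact: ab.
- move=> x j /allP be; rewrite ltNge; apply/negP => pos.
  have /(pP x).2 : h j - const_mx hi \in D x.
    by apply/mapP; exists j; rewrite ?mem_enum // ltNge pos.
  have [t [t0 ->]] := cone x; rewrite dot_suml; apply/negP; rewrite -leNgt.
  apply: sumr_le0 => l _; have wl : nth 0 (simplex g p S x) l \in simplex g p S x.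
    by rewrite mem_nth ?sz.
  rewrite dotZl mulr_ge0_le0 // dotBr dot_const (cellw _ _ wl).2 mulr1 subr_le0.
  exact: be.
- apply: leq_trans (size_simplices n0 indep gp S) _.
  by case: (n.-1) => // m; rewrite leq_exp2r // leq_mul2l leq_add2r Ss.
- apply: leq_trans Scount; rewrite leq_mul2r; apply/orP; right.
  apply: leq_sum => x _; apply/subset_leq_card/fintype.subsetP => j.
  rewrite !inE negb_or => /andP[na nb]; apply/andP; split.
    apply: contra na => /allP ab; apply/allP => v vw.
    by have := ab v vw; have := near x v j vw; rewrite ler_norml /lo; lra.
  apply: contra nb => /allP ab; apply/allP => v vw.
  by have := ab v vw; have := near x v j vw; rewrite ler_norml /hi; lra.
Qed.

(** On the hyperplane of points with coordinate sum 1, adding a large constant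
    to all coordinates and rescaling is a linear change of coordinates that
    brings finitely many points into the positive orthant; [h'] and [back] are
    the corresponding changes for functionals and vectors. *)
Lemma cutting (R : realType) (n : nat) (X J : finType) (u : X -> 'rV[R]_n)
    (h : J -> 'rV[R]_n) (s : nat) : (0 < n)%N ->
  (forall x, \sum_i u x 0 i = 1) ->
  exists (w : X -> seq 'rV[R]_n) (lo hi : R),
    [/\ forall x, size (w x) = n,
        forall x j, above (w x) lo (h j) -> 0 <= dot (u x) (h j),
        forall x j, below (w x) hi (h j) -> dot (u x) (h j) < 0,
        (size (undup [seq w x | x <- enum X]) <= (2 * (s + n)) ^ n.-1)%N
      & ((\sum_x #|[set j | ~~ above (w x) lo (h j) & ~~ below (w x) hi (h j)]|)
          * s.+1 <= #|X| * (n * n.+1) * #|J|)%N].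
Proof.
move=> n0 u1.
pose M : R := 1 + \sum_x \sum_i `|u x 0 i|.
have uM x i : 0 < u x 0 i + M.
  have : `|u x 0 i| <= \sum_x \sum_i `|u x 0 i|.
    rewrite (bigD1 x) //= (bigD1 i) //= -addrA lerDl addr_ge0 // ?sumr_ge0 //.
    by move=> y _; rewrite sumr_ge0.
  have := ler_norm (- u x 0 i); rewrite normrN /M; lra.
have M0 : 0 < M by rewrite /M ltr_pwDl // sumr_ge0 // => x _; rewrite sumr_ge0.
pose N : R := 1 + n%:R * M.
have N0 : 0 < N by rewrite /N ltr_pwDl // mulr_ge0 // ltW.
pose u' x := N^-1 *: (u x + const_mx M).
pose back (v : 'rV[R]_n) := N *: v - const_mx (M * \sum_i v 0 i).
pose h' j := N *: h j - const_mx (M * \sum_i h j 0 i).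
have sumE (v : 'rV[R]_n) : \sum_i v 0 i = dot v (const_mx 1).
  by rewrite dot_const mul1r.
have backE v j : dot v (h' j) = dot (back v) (h j).
  by rewrite dotBl dotBr dotZr dotZl (dotC (const_mx _)) !dot_const mulrAC.
have u'1 x : \sum_i u' x 0 i = 1.
  under eq_bigr do rewrite !mxE.
  rewrite -mulr_sumr big_split /= u1 sumr_const card_ord -mulr_natl mulVf //.
  by rewrite gt_eqF.
have u'E x j : dot (u' x) (h' j) = dot (u x) (h j).
  rewrite dotBr dot_const u'1 mulr1 dotZr dotZl dotDl (dotC (const_mx _)) dot_const.
  by rewrite mulrA divff ?gt_eqF // mul1r addrK.
have [||w [lo [hi [sz ab be cnt cr]]]] := @cutting_pos R n X J u' h' s n0.
- by move=> x i; rewrite !mxE mulr_gt0 // invr_gt0.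
- exact: u'1.
have abE x j : above (map back (w x)) lo (h j) = above (w x) lo (h' j).
  by rewrite /above all_map; apply: eq_all => v /=; rewrite backE.
have beE x j : below (map back (w x)) hi (h j) = below (w x) hi (h' j).
  by rewrite /below all_map; apply: eq_all => v /=; rewrite backE.
exists (fun x => map back (w x)), lo, hi; split.
- by move=> x; rewrite size_map.
- by move=> x j; rewrite abE -u'E; exact: ab.
- by move=> x j; rewrite beE -u'E; exact: be.
- apply: leq_trans cnt.
  rewrite -(size_map (map back) (undup [seq w x | x <- enum X])).
  apply: uniq_leq_size; first exact: undup_uniq.
  move=> z; rewrite mem_undup => /mapP[x xX ->]; apply/mapP; exists (w x) => //.
  by rewrite mem_undup; apply: map_f.
- apply: leq_trans cr; rewrite leq_mul2r; apply/orP; right.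
  apply: leq_sum => x _; apply: eq_leq; apply: eq_card => j.
  by rewrite !inE abE beE.
Qed.

Lemma cutting_on (R : realType) (n : nat) (X J : finType) (A : {set X})
    (B : {set J}) (u : X -> 'rV[R]_n) (h : J -> 'rV[R]_n) (s : nat) :
  (0 < n)%N -> (forall x, \sum_i u x 0 i = 1) ->
  exists (w : X -> seq 'rV[R]_n) (lo hi : R),
    [/\ forall x, x \in A -> size (w x) = n,
        forall x j, x \in A -> j \in B ->
          above (w x) lo (h j) -> 0 <= dot (u x) (h j),
        forall x j, x \in A -> j \in B ->
          below (w x) hi (h j) -> dot (u x) (h j) < 0,
        (size (undup [seq w x | x <- enum A]) <= (2 * (s + n)) ^ n.-1)%N
      & ((\sum_(x in A)
            #|[set j in B | ~~ above (w x) lo (h j) && ~~ below (w x) hi (h j)]|)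
          * s.+1 <= #|A| * (n * n.+1) * #|B|)%N].
Proof.
move=> n0 u1.
pose eA (i : 'I_#|A|) : X := enum_val i.
pose eB (j : 'I_#|B|) : J := enum_val j.
have [w0 [lo [hi [sz ab be cnt cr]]]] :=
  @cutting R n _ _ (fun i => u (eA i)) (fun j => h (eB j)) s n0 (fun i => u1 (eA i)).
pose w x := if [pick i | eA i == x] is Some i then w0 i else [::].
have wE i : w (eA i) = w0 i.
  rewrite /w; case: pickP => [k /eqP/enum_val_inj-> //|/(_ i)]; by rewrite eqxx.
have inA x : x \in A -> exists i, x = eA i.
  by move=> xA; exists (enum_rank_in xA x); rewrite /eA enum_rankK_in.
have inB j : j \in B -> exists i, j = eB i.
  by move=> jB; exists (enum_rank_in jB j); rewrite /eB enum_rankK_in.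
exists w, lo, hi; split.
- by move=> x /inA[i ->]; rewrite wE.
- by move=> x j /inA[i ->] /inB[l ->]; rewrite wE; exact: ab.
- by move=> x j /inA[i ->] /inB[l ->]; rewrite wE; exact: be.
- apply: leq_trans cnt; apply: uniq_leq_size; first exact: undup_uniq.
  move=> z; rewrite !mem_undup => /mapP[x]; rewrite mem_enum => /inA[i ->] ->.
  by rewrite wE; apply: map_f; rewrite mem_enum.
- rewrite !card_ord in cr; apply: leq_trans cr; rewrite leq_mul2r; apply/orP; right.
  rewrite big_enum_val /=; apply: leq_sum => i _.
  rewrite -(card_imset _ enum_val_inj); apply/subset_leq_card/fintype.subsetP => j.
  rewrite inE => /andP[/inB[l ->] cond]; apply/imsetP; exists l => //.
  by move: cond; rewrite inE -[enum_val i]/(eA i) wE.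
Qed.

(** * Treating one coordinate *)
Lemma card_small_fibres (R : realType) (X : finType) (W : eqType) (D : {set X})
    (w : X -> W) (s : seq W) (b : R) : (forall x, x \in D -> w x \in s) ->
  (forall x, x \in D -> #|[set y in D | w y == w x]|%:R <= b) -> 0 <= b ->
  #|D|%:R <= b * (size s)%:R.
Proof.
move=> Ds Db b0.
have le : (#|D| <= \sum_(v <- s) #|[set y in D | w y == v]|)%N.
  under eq_bigr do rewrite -sum1_card big_mkcond.
  rewrite exchange_big /= -sum1_card big_mkcond; apply: leq_sum => x _.
  case: ifPn => // xD; have := Ds x xD; elim: s {Ds} => // v s IH.
  rewrite inE big_cons => /predU1P[<-|/IH h]; first by rewrite inE xD eqxx.
  by apply: leq_trans h _; rewrite leq_addl.
apply: (@le_trans _ _ (\sum_(v <- s) #|[set y in D | w y == v]|)%N%:R).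
  by rewrite ler_nat.
rewrite natr_sum -[X in b * X%:R]sum1_size natr_sum mulr_sumr; apply: ler_sum => v _.
rewrite mulr1; case: (set_0Vmem [set y in D | w y == v]) => [->|[x]].
  by rewrite cards0.
by rewrite inE => /andP[xD /eqP <-]; exact: Db.
Qed.

Section Step.
Variables (R : realType) (n k : nat) (X : finType) (V : Type).
Variables (pt : X -> V) (z : 'I_n -> V) (l : X -> 'rV[R]_n).
Hypotheses (n0 : (0 < n)%N) (l1 : forall x, \sum_a l x 0 a = 1).
Implicit Types (q : {ffun 'I_k -> V}) (p : {ffun 'I_k -> X}) (c i : 'I_k).

Definition upd (W : Type) (q : {ffun 'I_k -> W}) i (y : W) : {ffun 'I_k -> W} :=
  [ffun j => if j == i then y else q j].

Lemma updC (W : Type) (q : {ffun 'I_k -> W}) i j (y y' : W) :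
  i != j -> upd (upd q i y) j y' = upd (upd q j y') i y.
Proof.
move=> ij; apply/ffunP => c; rewrite !ffunE; case: eqP => // ->.
by case: eqP => // e; rewrite e eqxx in ij.
Qed.

Lemma upd2 (W : Type) (q : {ffun 'I_k -> W}) i (y y' : W) :
  upd (upd q i y) i y' = upd q i y'.
Proof. by apply/ffunP => c; rewrite !ffunE; case: eqP. Qed.

Lemma upd_id (W : Type) (q : {ffun 'I_k -> W}) i : upd q i (q i) = q.
Proof. by apply/ffunP => c; rewrite !ffunE; case: eqP => // ->. Qed.

(** In each variable, the function is determined by its values at the nodes
    [z] and is linear in the coordinates [l x] relative to them. *)
Definition separately_spanned (G : {ffun 'I_k -> V} -> R) : Prop :=
  forall q i x, G (upd q i (pt x)) = \sum_a l x 0 a * G (upd q i (z a)).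

Definition indep_of i (G : {ffun 'I_k -> V} -> R) : Prop :=
  forall q y, G (upd q i y) = G q.

(** Substitutes the formal combination of nodes with weights [v] for the
    [i]-th variable; for [v = l x] this is the substitution of [x].  The
    vectors provided by a cutting need not come from points. *)
Definition mix i (v : 'rV[R]_n) (G : {ffun 'I_k -> V} -> R) q : R :=
  \sum_a v 0 a * G (upd q i (z a)).

Lemma indep_mix i v G : indep_of i (mix i v G).
Proof. by move=> q y; apply: eq_bigr => a _; rewrite upd2. Qed.

Lemma indep_mix_of i c v G : indep_of c G -> indep_of c (mix i v G).
Proof.
have [->|ci] := eqVneq c i; first by move=> _; exact: indep_mix.
by move=> GI q y; apply: eq_bigr => a _; rewrite updC // GI.
Qed.

Lemma separately_spanned_affine (e b : R) G :
  separately_spanned G -> separately_spanned (fun q => e * G q + b).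
Proof.
move=> sG q i x; rewrite sG mulr_sumr.
rewrite -[b in LHS]mul1r -(l1 x) mulr_suml -big_split /=.
by apply: eq_bigr => a _; rewrite mulrDr mulrCA.
Qed.

(** The substitutions in different variables commute; in the variable [i] the
    function has become constant, and the coordinates [l x] have sum 1. *)
Lemma separately_spanned_mix i v G :
  separately_spanned G -> separately_spanned (mix i v G).
Proof.
move=> sG q c x; have [->|ci] := eqVneq c i.
  rewrite indep_mix; under eq_bigr do rewrite indep_mix.
  by rewrite -mulr_suml l1 mul1r.
rewrite /mix; under eq_bigr do rewrite updC // sG mulr_sumr.
rewrite exchange_big /=; apply: eq_bigr => a _.
rewrite mulr_sumr; apply: eq_bigr => a' _.
by rewrite mulrCA updC // eq_sym.
Qed.

Definition lift_pt p : {ffun 'I_k -> V} := [ffun c => pt (p c)].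

Lemma lift_upd p i x : lift_pt (upd p i x) = upd (lift_pt p) i (pt x).
Proof. by apply/ffunP => c; rewrite !ffunE; case: eqP. Qed.

Definition holds (T : finType) (G : T -> {ffun 'I_k -> V} -> R)
    (Phi : {ffun T -> bool} -> bool) p : bool :=
  Phi [ffun j => 0 <= G j (lift_pt p)].

Variable P : 'I_k -> {set X}.
Hypothesis Pne : forall c, (0 < #|P c|)%N.

Definition box : {set {ffun 'I_k -> X}} :=
  [set p : {ffun 'I_k -> X} | [forall c : 'I_k, p c \in P c]].

Lemma card_box : #|box| = (\prod_c #|P c|)%N.
Proof.
have -> : #|box| = #|(family (fun c => mem (P c)) : pred {ffun 'I_k -> X})|.
  by apply: eq_card => p; rewrite inE; apply/forallP/familyP.
by rewrite card_family foldrE big_map big_enum.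
Qed.

Lemma upd_box p i x : x \in P i -> p \in box -> upd p i x \in box.
Proof.
move=> xP; rewrite !inE => /forallP pP; apply/forallP => c; rewrite ffunE.
by case: eqP => [->|].
Qed.

(** Exchanging [x] with the [i]-th entry of [p] is an involution. *)
Lemma sum_upd i (F : {ffun 'I_k -> X} -> nat) :
  (\sum_(x in P i) \sum_(p in box) F (upd p i x) =
   #|P i| * \sum_(p in box) F p)%N.
Proof.
rewrite -sum_nat_const !pair_big /=.
rewrite (reindex_onto (fun u : X * {ffun 'I_k -> X} => (u.2 i, upd u.2 i u.1))
                      (fun u => (u.2 i, upd u.2 i u.1))) /=; last first.
  by move=> [x p] _ /=; rewrite ffunE eqxx upd2 upd_id.
apply: eq_big => [[x p] /=|[x p] _ /=]; last by rewrite upd2 upd_id.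
rewrite ffunE eqxx upd2 upd_id eqxx andbT.
apply/idP/idP => /andP[h1 h2]; last first.
  by rewrite upd_box // andbT; move: h2; rewrite inE => /forallP.
have xP : x \in P i.
  by move: h2; rewrite inE => /forallP/(_ i); rewrite ffunE eqxx.
rewrite xP /=; have := upd_box h1 h2; by rewrite upd2 upd_id.
Qed.

(** The functionals on the [i]-th variable, one for each tuple of the other
    variables and each [G j], are cut with parameter [s].  Consider the pairs of
    a point of [P i] and a tuple that holds once the point is substituted; they
    are a proportion at least [eps] of all pairs.  At most [eps / 8] is lost to
    tuples split by some functional on the class of the point, at most
    [eps / 4] to points in classes with less than [eps / (4 M)] of [P i].  So
    some point in a larger class admits [eps / 2] of the tuples, and its class
    admits them as a whole.  Whether a tuple is of this kind is tested by [Gn]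
    at the vectors of the class, which no longer involves the [i]-th
    variable. *)
Lemma coordinate_step (T : finType) (G : T -> {ffun 'I_k -> V} -> R)
    (Phi : {ffun T -> bool} -> bool) (i : 'I_k) (eps : R) (s : nat) :
  (forall j, separately_spanned (G j)) -> 0 < eps ->
  eps * #|box|%:R <= #|[set p in box | holds G Phi p]|%:R ->
  8 * (n * n.+1)%:R * #|T|%:R <= eps * s.+1%:R ->
  exists (C : {set X}) (G' : T * 'I_n * bool -> {ffun 'I_k -> V} -> R)
      (Phi' : {ffun T * 'I_n * bool -> bool} -> bool),
    [/\ C \subset P i /\
        eps * #|P i|%:R <= 4 * ((2 * (s + n)) ^ n.-1)%:R * #|C|%:R,
        forall j, separately_spanned (G' j),
        forall c, c = i \/ (forall j, indep_of c (G j)) ->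
          forall j, indep_of c (G' j),
        forall p, p \in box -> p i \in C -> holds G' Phi' p -> holds G Phi p
      & eps / 2 * #|box|%:R <= #|[set p in box | holds G' Phi' p]|%:R].
Proof.
move=> sG eps0 dens s_big.
pose B := setX box [set: T].
pose h (e : {ffun 'I_k -> X} * T) : 'rV[R]_n :=
  \row_a G e.2 (upd (lift_pt e.1) i (z a)).
have dot_h v p j : dot v (h (p, j)) = mix i v (G j) (lift_pt p).
  by apply: eq_bigr => a _; rewrite mxE.
have dot_lh x p j : dot (l x) (h (p, j)) = G j (lift_pt (upd p i x)).
  by rewrite dot_h lift_upd sG.
have [w [lo [hi [sz ab be cnt cr]]]] := cutting_on (P i) B h s n0 l1.
pose Gn (om : seq 'rV[R]_n) (e : T * 'I_n * bool) q :=
  let v := nth 0 om e.1.2 in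
  if e.2 then 1 * mix i v (G e.1.1) q + - lo
  else -1 * mix i v (G e.1.1) q + hi.
pose Phin (f : {ffun T * 'I_n * bool -> bool}) :=
  [forall j, [forall a, f (j, a, true)] || [forall a, f (j, a, false)]] &&
  Phi [ffun j => [forall a, f (j, a, true)]].
have aboveE x p j : x \in P i ->
    above (w x) lo (h (p, j)) = [forall a, 0 <= Gn (w x) (j, a, true) (lift_pt p)].
  move=> xP; have sx := sz x xP; rewrite /above; apply/(all_nthP 0)/forallP => H a.
    by rewrite /Gn /= mul1r subr_ge0 -dot_h; apply: H; rewrite sx.
  rewrite sx => an; have := H (Ordinal an).
  by rewrite /Gn /= mul1r subr_ge0 -dot_h.
have belowE x p j : x \in P i ->
    below (w x) hi (h (p, j)) = [forall a, 0 <= Gn (w x) (j, a, false) (lift_pt p)].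
  move=> xP; have sx := sz x xP; rewrite /below; apply/(all_nthP 0)/forallP => H a.
    by rewrite /Gn /= mulN1r addrC subr_ge0 -dot_h; apply: H; rewrite sx.
  rewrite sx => an; have := H (Ordinal an).
  by rewrite /Gn /= mulN1r addrC subr_ge0 -dot_h.
pose ok x p := [forall j, above (w x) lo (h (p, j)) || below (w x) hi (h (p, j))].
have holdsn x p : x \in P i -> p \in box ->
    holds (Gn (w x)) Phin p = ok x p && holds G Phi (upd p i x).
  move=> xP pB.
  have okE : [forall j, [forall a, 0 <= Gn (w x) (j, a, true) (lift_pt p)] ||
                        [forall a, 0 <= Gn (w x) (j, a, false) (lift_pt p)]] = ok x p.
    by apply: eq_forallb => j; rewrite aboveE ?belowE.
  rewrite /holds /Phin.
  under eq_forallb => j.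
    under eq_forallb do rewrite ffunE.
    under [X in _ || X]eq_forallb do rewrite ffunE.
    over.
  rewrite okE; have [okx|//] := boolP (ok x p); rewrite /=.
  congr Phi; apply/ffunP => j; rewrite !ffunE.
  under eq_forallb do rewrite ffunE.
  rewrite -aboveE // -dot_lh.
  have jB : (p, j) \in B by rewrite inE pB inE.
  have /forallP/(_ j)/orP[a|b] := okx; first by rewrite a ab.
  have neg := be _ _ xP jB b; rewrite leNgt neg.
  by apply: contraTF neg => a; rewrite -leNgt ab.
pose TT x := [set p in box | holds (Gn (w x)) Phin p].
pose E0 := [set p in box | holds G Phi p].
pose bad x := [set e in B | ~~ above (w x) lo (h e) && ~~ below (w x) hi (h e)].
have count : (#|P i| * #|E0| <= \sum_(x in P i) #|TT x| + \sum_(x in P i) #|bad x|)%N.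
  have -> : #|E0| = (\sum_(p in box) holds G Phi p)%N.
    rewrite -sum1_card big_mkcond [RHS]big_mkcond; apply: eq_bigr => p _.
    by rewrite inE; case: (p \in box); case: holds.
  rewrite -(sum_upd i (fun p => holds G Phi p : nat)) -big_split /=.
  apply: leq_sum => x xP.
  have -> : (\sum_(p in box) holds G Phi (upd p i x) =
             #|[set p in box | holds G Phi (upd p i x)]|)%N.
    rewrite -sum1_card big_mkcond [RHS]big_mkcond; apply: eq_bigr => p _.
    by rewrite inE; case: (p \in box); case: holds.
  apply: leq_trans (leq_add (leqnn _) (leq_imset_card fst (bad x))).
  apply: leq_trans (leq_card_setU _ _); apply/subset_leq_card/fintype.subsetP => p.
  rewrite inE => /andP[pB hp]; apply/setUP.
  have [okx|/forallPn[j]] := boolP (ok x p).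
    by left; rewrite inE pB holdsn // okx hp.
  rewrite negb_or => bj; right.
  by apply/imsetP; exists (p, j) => //; rewrite inE bj andbT in_setX pB in_setT.
pose Y : R := #|P i|%:R; pose N : R := #|box|%:R.
have Y0 : 0 < Y by rewrite ltr0n.
have N0 : 0 < N by rewrite ltr0n card_box prodn_gt0.
have {cr} badle : 8 * (\sum_(x in P i) #|bad x|)%:R <= eps * Y * N.
  move: cr; rewrite /B cardsX cardsT -(ler_nat R) !natrM.
  set b := (\sum_(x in P i) _)%N%:R => cr.
  have s0 : 0 < (s.+1%:R : R) by rewrite ltr0n.
  rewrite -(ler_pM2r s0).
  apply: (@le_trans _ _ (8 * (Y * (n%:R * n.+1%:R) * (N * #|T|%:R)))).
    by rewrite -[leLHS]mulrA ler_pM2l.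
  rewrite natrM in s_big.
  have YN : 0 < Y * N by rewrite mulr_gt0.
  have := s_big; rewrite -(ler_pM2l YN) => h1.
  by apply: le_trans (le_trans h1 _); rewrite le_eqVlt; apply/orP; left; apply/eqP; ring.
pose M : R := ((2 * (s + n)) ^ n.-1)%:R.
have M0 : 0 < M by rewrite ltr0n expn_gt0 muln_gt0 addn_gt0 n0 orbT.
have [[x [xP Cx Tx]]|none] := boolp.pselect (exists x, [/\ x \in P i,
   eps * Y <= 4 * M * #|[set y in P i | w y == w x]|%:R & eps / 2 * N <= #|TT x|%:R]).
  exists [set y in P i | w y == w x], (Gn (w x)), Phin; split=> //.
  - by split=> //; apply/fintype.subsetP => y; rewrite inE => /andP[].
  - by move=> [[j a] []]; apply: separately_spanned_affine; exact: separately_spanned_mix.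
  - move=> c ci [[j a] b].
    have ind v : indep_of c (mix i v (G j)).
      by case: ci => [->|cG]; [exact: indep_mix | exact: indep_mix_of].
    by case: b => q y; rewrite /Gn /= ind.
  - move=> p pB; rewrite inE => /andP[piP /eqP e].
    rewrite -e holdsn // => /andP[_]; by rewrite upd_id.
exfalso.
pose D := [set x in P i | 4 * M * #|[set y in P i | w y == w x]|%:R < eps * Y].
have Dle : #|D|%:R <= eps * Y / 4.
  apply: (@le_trans _ _ (eps * Y / (4 * M) *
      (size (undup [seq w x | x <- enum (P i)]))%:R)).
    apply: card_small_fibres => [x|x xD|].
    - by rewrite inE mem_undup => /andP[xP _]; apply: map_f; rewrite mem_enum.
    - rewrite ler_pdivlMr ?mulr_gt0 // mulrC.
      move: xD; rewrite inE => /andP[_ /ltW]; apply: le_trans.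
      rewrite ler_pM2l ?mulr_gt0 // ler_nat subset_leq_card //.
      by apply/fintype.subsetP => y; rewrite !inE => /andP[/andP[-> _] ->].
    - by rewrite divr_ge0 ?mulr_ge0 // ltW.
  have : (size (undup [seq w x | x <- enum (P i)]))%:R <= M by rewrite ler_nat.
  have e0 : 0 < eps * Y / (4 * M) by rewrite divr_gt0 ?mulr_gt0.
  rewrite -(ler_pM2l e0) => /le_trans; apply.
  by rewrite le_eqVlt; apply/orP; left; apply/eqP; field; rewrite gt_eqF.
have sumT : (\sum_(x in P i) #|TT x|)%:R <= #|D|%:R * N + Y * (eps / 2 * N).
  rewrite natr_sum (bigID (mem D)) /=; apply: lerD.
    apply: (@le_trans _ _ (\sum_(x in P i | x \in D) N)).
      apply: ler_sum => x _; rewrite ler_nat subset_leq_card //.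
      by apply/fintype.subsetP => p; rewrite inE => /andP[].
    rewrite sumr_const -[leLHS]mulr_natl ler_pM2r // ler_nat subset_leq_card //.
    by apply/fintype.subsetP => x /andP[].
  apply: (@le_trans _ _ (\sum_(x in P i) eps / 2 * N)); last first.
    by rewrite sumr_const -[leLHS]mulr_natl.
  rewrite [leRHS](bigID (mem D)) /=; apply: ler_wpDl.
    by apply: sumr_ge0 => x _; rewrite mulr_ge0 ?divr_ge0 // ltW.
  apply: ler_sum => x /andP[xP]; rewrite inE xP /= -leNgt => Cx.
  rewrite leNgt; apply/negP => /ltW Tx; apply: none; exists x; split=> //.
have densY : eps * Y * N <= #|P i|%:R * #|E0|%:R.
  by rewrite mulrAC mulrC -/Y ler_pM2l.
have : (#|P i| * #|E0|)%:R <=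
    (\sum_(x in P i) #|TT x| + \sum_(x in P i) #|bad x|)%:R :> R by rewrite ler_nat.
rewrite natrM natrD => c1.
have DN : #|D|%:R * N <= eps * Y / 4 * N by rewrite ler_pM2r.
have YN : 0 < eps * Y * N by rewrite !mulr_gt0.
lra.
Qed.

End Step.

(** * Iteration over the coordinates *)

(** In round [c] the density is [eps / 2 ^ c] and the number of functions is
    [(2 n) ^ c t], so that [eps (s + n)] is at most [n ^ (8 + 3 c) t]; this
    uses [4 <= n ^ 2] and bounds the constants by powers of [n]. *)
Lemma size_bound (R : realType) (n k c t s : nat) (eps Y A : R) :
  (1 < n)%N -> (c < k)%N -> (0 < t)%N -> 0 < eps <= 1 -> 0 <= Y ->
  eps * s%:R <= 8 * (n * n.+1)%:R * ((2 * n) ^ c * t)%:R * 2 ^+ c ->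
  eps / 2 ^+ c * Y <= 4 * ((2 * (s + n)) ^ n.-1)%:R * A ->
  eps ^+ n / (n%:R ^+ (20 * n.-1 * k) * t%:R ^+ n.-1) * Y <= A.
Proof.
move=> n1 ck t0 /andP[e0 e1] Y0 sle YA.
set m := n.-1; have m0 : (0 < m)%N by rewrite /m; lia.
have nm : n = m.+1 by rewrite /m; lia.
have n2 : 2 <= n%:R :> R by rewrite ler_nat.
have n_ge1 : 1 <= n%:R :> R by rewrite ler1n ltnW.
have t_ge1 : 1 <= t%:R :> R by rewrite ler1n.
have p2c : 0 < 2 ^+ c :> R by rewrite exprn_gt0.
pose W : R := ((2 * (s + n)) ^ m)%:R.
have W0 : 0 < W by rewrite ltr0n expn_gt0 muln_gt0 addn_gt0 orbC (ltnW n1) !orbT.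
have four : (4 : R) <= n%:R ^+ 2 by nra.
have Q : eps * (2 * (s + n))%:R <= n%:R ^+ (8 + 3 * c) * t%:R.
  rewrite natrM natrD mulrCA mulrDr.
  have tc1 : 1 <= (4 * n%:R) ^+ c * t%:R :> R.
    by rewrite mulr_ege1 // exprn_ege1 //; lra.
  have sle' : eps * s%:R <= 8 * (n%:R * n.+1%:R) * ((4 * n%:R) ^+ c * t%:R).
    apply: le_trans sle _; rewrite !natrM natrX natrM.
    rewrite le_eqVlt; apply/orP; left; apply/eqP.
    have -> : (4 * n%:R) ^+ c = (2 * n%:R) ^+ c * 2 ^+ c :> R.
      by rewrite -exprMn; congr (_ ^+ _); ring.
    ring.
  have en : eps * n%:R <= n%:R * ((4 * n%:R) ^+ c * t%:R).
    apply: (@le_trans _ _ n%:R); first by rewrite ler_piMl // (le_trans _ n_ge1).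
    by rewrite ler_peMr // (le_trans _ n_ge1).
  have c8 : 2 * (8 * (n%:R * n.+1%:R) + n%:R) <= n%:R ^+ 8 :> R.
    rewrite -natr1; have : (64 : R) <= n%:R ^+ 6.
      have -> : (64 : R) = 4 ^+ 3 by rewrite -natrX.
      by rewrite (exprM _ 2 3) lerXn2r // nnegrE // ?(le_trans _ four).
    move=> n6; rewrite (exprD _ 6 2).
    have : 64 * n%:R ^+ 2 <= n%:R ^+ 6 * n%:R ^+ 2 :> R.
      by rewrite ler_wpM2r // sqr_ge0.
    nra.
  have c3 : (4 * n%:R) ^+ c <= n%:R ^+ (3 * c) :> R.
    rewrite exprM lerXn2r ?nnegrE ?exprn_ge0 ?mulr_ge0 //.
    have -> : n%:R ^+ 3 = n%:R ^+ 2 * n%:R :> R by ring.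
    by rewrite ler_wpM2r.
  apply: (@le_trans _ _ (2 * (8 * (n%:R * n.+1%:R) + n%:R) *
                        ((4 * n%:R) ^+ c * t%:R))).
    rewrite -mulrA ler_pM2l // [leRHS]mulrDl; exact: lerD.
  rewrite exprD -[leRHS]mulrA; apply: ler_pM => //.
  - by rewrite mulr_ge0 // addr_ge0 // !mulr_ge0.
  - by rewrite mulr_ge0 // exprn_ge0 // mulr_ge0.
  - by rewrite ler_wpM2r.
have main : eps ^+ m * 2 ^+ c * (4 * W) <= n%:R ^+ (20 * m * k) * t%:R ^+ m.
  apply: (@le_trans _ _ (n%:R ^+ (c + 2) * (n%:R ^+ (8 + 3 * c) * t%:R) ^+ m)).
    have -> : eps ^+ m * 2 ^+ c * (4 * W) =
        (2 ^+ c * 4) * (eps * (2 * (s + n))%:R) ^+ m.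
      rewrite /W natrX exprMn; ring.
    apply: ler_pM.
    - by rewrite mulr_ge0 // ltW.
    - by rewrite exprn_ge0 // mulr_ge0 // ltW.
    - rewrite exprD; apply: ler_pM => //; first exact: ltW.
      by rewrite lerXn2r // nnegrE.
    - apply: lerXn2r => //; rewrite nnegrE mulr_ge0 //; first exact: ltW.
      exact: exprn_ge0.
  rewrite exprMn mulrA ler_wpM2r // ?exprn_ge0 // -exprM -exprD.
  apply: ler_weXn2l; first by [].
  have h1 : (c <= c * m)%N by rewrite leq_pmulr.
  have h2 : (m + c * m <= m * k)%N by rewrite [X in (_ + X)%N]mulnC -mulnS leq_mul2l ck orbT.
  rewrite mulnDl -!mulnA.
  move: (c * m)%N (m * k)%N h1 h2 m0 => cm mk; clear; lia.
have D0 : 0 < n%:R ^+ (20 * m * k) * t%:R ^+ m :> R.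
  by rewrite mulr_gt0 // exprn_gt0 // (lt_le_trans _ n_ge1, lt_le_trans _ t_ge1).
rewrite -(ler_pM2r (_ : 0 < 4 * W)) ?mulr_gt0 // [A * _]mulrC.
apply: le_trans YA.
rewrite mulrAC ler_wpM2r //.
have -> : eps ^+ n = eps ^+ m * eps by rewrite -exprSr -nm.
rewrite ler_pdivlMr //.
have -> : eps ^+ m * eps / (n%:R ^+ (20 * m * k) * t%:R ^+ m) * (4 * W) * 2 ^+ c
  = eps * ((eps ^+ m * 2 ^+ c * (4 * W)) / (n%:R ^+ (20 * m * k) * t%:R ^+ m)) by ring.
by rewrite ler_piMr //; [exact: ltW|rewrite ler_pdivrMr // mul1r].
Qed.

Section Density.
Variables (R : realType) (n k : nat) (X : finType) (V : Type).
Variables (pt : X -> V) (z : 'I_n -> V) (l : X -> 'rV[R]_n).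
Hypotheses (n1 : (1 < n)%N) (l1 : forall x, \sum_a l x 0 a = 1).
Variable P : 'I_k -> {set X}.
Hypothesis Pne : forall c, (0 < #|P c|)%N.

(** The functions left after [m] rounds do not depend on the first [m]
    variables, whose subsets are already chosen.  After all rounds they are
    constant, and the condition, being satisfied with positive density, holds
    everywhere. *)
Lemma product_density (T0 : finType) (G0 : T0 -> {ffun 'I_k -> V} -> R)
    (Phi0 : {ffun T0 -> bool} -> bool) (eps : R) :
  (forall j, separately_spanned pt z l (G0 j)) -> 0 < eps -> (0 < #|T0|)%N ->
  eps * #|box P|%:R <= #|[set p in box P | holds pt G0 Phi0 p]|%:R ->
  exists A : 'I_k -> {set X},
    [/\ forall c, A c \subset P c,
        forall c, eps ^+ n / (n%:R ^+ (20 * n.-1 * k) * #|T0|%:R ^+ n.-1)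
                  * #|P c|%:R <= #|A c|%:R
      & forall p : {ffun 'I_k -> X}, (forall c, p c \in A c) -> holds pt G0 Phi0 p].
Proof.
move=> sG0 e0 t0 dens0.
have n0 : (0 < n)%N by apply: ltnW.
have B0 : 0 < #|box P|%:R :> R by rewrite ltr0n card_box prodn_gt0.
have e1 : eps <= 1.
  rewrite -(ler_pM2r B0) mul1r (le_trans dens0) // ler_nat subset_leq_card //.
  by apply/fintype.subsetP => p; rewrite inE => /andP[].
set bnd := _ / _.
suff /(_ k (leqnn k))[A [T [G [Phi [_ _ iG [AP As sound dens]]]]]] :
  forall m, (m <= k)%N -> exists (A : 'I_k -> {set X}) (T : finType)
      (G : T -> {ffun 'I_k -> V} -> R) (Phi : {ffun T -> bool} -> bool),
    [/\ #|T| = ((2 * n) ^ m * #|T0|)%N,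
        forall j, separately_spanned pt z l (G j),
        forall c : 'I_k, (c < m)%N -> forall j, indep_of c (G j)
      & [/\ forall c, A c \subset P c,
        forall c : 'I_k, (c < m)%N -> bnd * #|P c|%:R <= #|A c|%:R,
        forall p : {ffun 'I_k -> X}, p \in box P -> (forall c : 'I_k, (c < m)%N -> p c \in A c) ->
          holds pt G Phi p -> holds pt G0 Phi0 p
      & eps / 2 ^+ m * #|box P|%:R <= #|[set p in box P | holds pt G Phi p]|%:R]].
  exists A; split=> // [c|p pA]; first exact: As.
  have /card_gt0P[p0] : (0 < #|[set p in box P | holds pt G Phi p]|)%N.
    rewrite -(ltr_nat R); apply: lt_le_trans dens.
    by rewrite mulr_gt0 // divr_gt0 // exprn_gt0.
  rewrite inE => /andP[p0B hp0]; apply: sound => //.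
    by rewrite inE; apply/forallP => c; apply: (fintype.subsetP (AP c)).
  have Gc j (q q' : {ffun 'I_k -> V}) : G j q = G j q'.
    suff H (r : seq 'I_k) : G j [ffun c => if c \in r then q' c else q c] = G j q.
      rewrite -(H (enum 'I_k)); congr (G j).
      by apply/ffunP => c; rewrite ffunE mem_enum.
    elim: r => [|c r <-]; first by congr (G j); apply/ffunP => c; rewrite ffunE.
    rewrite -(iG c (ltn_ord c) j [ffun c0 => if c0 \in r then q' c0 else q c0] (q' c)).
    congr (G j); apply/ffunP => c'; rewrite !ffunE inE.
    by case: eqP => [->|].
  by move: hp0; rewrite /holds; congr Phi; apply/ffunP => j; rewrite !ffunE (Gc j _ (lift_pt pt p)).
elim=> [_|m IH mk].
  exists P, T0, G0, Phi0; split=> //; first by rewrite expn0 mul1n.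
  by split=> //; rewrite expr0 divr1.
have [A [T [G [Phi [Tc sG iG [AP As sound dens]]]]]] := IH (ltnW mk).
pose i := Ordinal mk; pose em := eps / 2 ^+ m.
have p2 : 0 < 2 ^+ m :> R by rewrite exprn_gt0.
have em0 : 0 < em by rewrite divr_gt0.
(* With s + 1 > y the functionals that split a class cost em / 8. *)
pose y := 8 * (n * n.+1)%:R * #|T|%:R / em.
have y0 : 0 <= y by apply: divr_ge0; [rewrite !mulr_ge0 | exact: ltW].
have /andP[sy ys] := Num.Theory.truncn_itv y0.
set s := Num.truncn y in sy ys.
have [|C [G' [Phi' [[CP Cs] sG' iG' sound' dens']]]] :=
    coordinate_step n0 l1 Pne i (s := s) sG em0 dens.
  by rewrite -ler_pdivrMl // mulrC ltW.
exists (fun c => if c == i then C else A c), _, G', Phi'; split=> //.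
- by rewrite !card_prod card_ord card_bool Tc expnS; ring.
- move=> c; rewrite ltnS leq_eqVlt => /orP[/eqP cm|cm]; apply: iG'; last by right; exact: iG.
  by left; apply: val_inj.
split.
- by move=> c; case: eqP => [->|].
- move=> c; case: eqP => [-> _|ci]; last first.
    rewrite ltnS leq_eqVlt => /orP[/eqP cm|]; last exact: As.
    by case: ci; apply: val_inj.
  apply: (size_bound (s := s) n1 mk t0 _ _ _ Cs) => //; first by rewrite e0.
  have : em * s%:R <= 8 * (n * n.+1)%:R * #|T|%:R.
    by rewrite mulrC -ler_pdivlMr.
  by rewrite /em mulrAC ler_pdivrMr // Tc.
- move=> p pB pA hp; apply: sound => // [c cm|].
    have := pA c; case: eqP => [ci|_]; last by apply; rewrite ltnS ltnW.
    by rewrite ci /= ltnn in cm.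
  apply: sound' => //; by have := pA i; rewrite eqxx; apply; rewrite ltnS.
- by move: dens'; rewrite /em exprSr invfM mulrA.
Qed.

End Density.

(** * Semi-algebraic hypergraphs *)

(** The nodes are a maximal family with independent values of [phi], completed
    arbitrarily to the prescribed length. *)
Lemma spanning_nodes (R : realType) (M N : nat) (V : Type) (v0 : V)
    (phi : V -> 'rV[R]_M) : (M <= N)%N ->
  exists (z : 'I_N -> V) (l : V -> 'rV[R]_N),
    forall x, phi x = \sum_a l x 0 a *: phi (z a).
Proof.
move=> MN.
pose free m := exists z : 'I_m -> V, forall c : 'I_m -> R,
  \sum_a c a *: phi (z a) = 0 -> forall a, c a = 0.
have free0 : exists m, boolp.asbool (free m).
  exists 0%N; apply/boolp.asboolP; exists (fun=> v0) => c _ [] //.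
have freeM m : boolp.asbool (free m) -> (m <= M)%N.
  move=> /boolp.asboolP[z zi]; rewrite leqNgt; apply/negP => Mm.
  have [|c [[a _ ca] c0]] := @lin_dep R M 'I_m [set: 'I_m] (fun a => phi (z a)).
    by rewrite cardsT card_ord.
  move: ca; rewrite (zi c) ?eqxx // -[RHS]c0.
  by apply: eq_bigl => b; rewrite inE.
case: (ex_maxnP free0 freeM) => m mfree mmax.
have mN := leq_trans (freeM m mfree) MN.
have /boolp.asboolP[z zi] := mfree.
have span x : exists c : 'I_m -> R, phi x = \sum_a c a *: phi (z a).
  have [//|nspan] := boolp.pselect (exists c : 'I_m -> R, phi x = \sum_a c a *: phi (z a)).
  suff /boolp.asboolP/mmax : free m.+1 by rewrite ltnn.
  exists (fun a => if unlift ord_max a is Some b then z b else x) => c.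
  have wE (b : 'I_m) : widen_ord (leqnSn m) b = lift ord_max b.
    by apply: val_inj; rewrite /= /bump leqNgt ltn_ord.
  rewrite big_ord_recr /= unlift_none.
  under eq_bigr do rewrite wE liftK.
  have [cm|cm] := eqVneq (c ord_max) 0 => c0.
    rewrite cm scale0r addr0 in c0.
    by move=> a; case: (unliftP ord_max a) => [b ->|-> //]; apply: (zi _ c0).
  case: nspan; exists (fun b => - (c (lift ord_max b) / c ord_max)).
  apply: (scalerI cm); move/eqP: c0; rewrite addrC addr_eq0 => /eqP ->.
  rewrite -sumrN scaler_sumr; apply: eq_bigr => b _.
  by rewrite -scaleNr scalerA mulrN mulrCA divff ?mulr1.
have [l lP] := boolp.choice span.
pose z' (a : 'I_N) := if insub (val a) is Some b then z b else v0.
pose l' x : 'rV[R]_N := \row_a (if insub (val a) is Some b then l x b else 0).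
exists z', l' => x; rewrite lP.
rewrite (bigID (fun a : 'I_N => (a < m)%N)) /= [X in _ + X]big1 ?addr0; last first.
  by move=> a am; rewrite mxE insubN ?scale0r.
rewrite (big_ord_narrow mN); apply: eq_bigr => b _.
by rewrite mxE /z' /= valK.
Qed.

Section Polynomials.
Import mpoly.
Variables (R : realType) (d k D : nat).

(** Homogenization by one more variable, of exponent [D - mdeg m]. *)
Lemma card_bmultinom : (#|{: 'X_{1..d < D.+1}}| <= 'C(d + D, d))%N.
Proof.
pose F (m : 'X_{1..d < D.+1}) : 'X_{1..d.+1} :=
  [multinom (if unlift ord0 i is Some j then bmnm m j else (D - mdeg m)%N) | i < d.+1].
have Fi : injective F.
  move=> m1 m2 /mnmP e; apply: val_inj; apply/mnmP => j.
  by have := e (lift ord0 j); rewrite !mnmE liftK.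
have sz : size [seq s2m t | t : D.-tuple 'I_d.+1 <- enum (basis d.+1 D)] = 'C(d + D, d).
  by rewrite size_basis addnC -bin_sub ?leq_addl // addnK.
rewrite -sz cardE -(size_map F); apply: uniq_leq_size.
  by rewrite map_inj_uniq ?enum_uniq.
move=> _ /mapP[m _ ->]; rewrite -basis_cover; apply/eqP.
rewrite mdegE big_ord_recl mnmE unlift_none.
under eq_bigr do rewrite mnmE liftK.
by rewrite -mdegE subnK // -ltnS bmdeg.
Qed.

Definition monomials (x : 'rV[R]_d) : 'rV[R]_#|{: 'X_{1..d < D.+1}}| :=
  \row_a \prod_(j < d) x 0 j ^+ (bmnm (enum_val a) j).

Lemma monomials_const : exists a, forall x, monomials x 0 a = 1.
Proof.
have m0 : (mdeg (0%MM : 'X_{1..d}) < D.+1)%N by rewrite mdeg0.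
exists (enum_rank (BMultinom m0)) => x; rewrite mxE enum_rankK /=.
by rewrite big1 // => j _; rewrite mnm0E expr0.
Qed.

Lemma meval_monomials (g : {mpoly R[d]}) : (msize g <= D.+1)%N ->
  exists c, forall x : 'rV[R]_d, g.@[fun j => x 0 j] = dot (monomials x) c.
Proof.
move=> gD; exists (\row_a g@_(bmnm (enum_val a))) => x.
rewrite [in LHS](mpolywE gD) raddf_sum /=.
rewrite (reindex (fun a : 'I_#|{: 'X_{1..d < D.+1}}| => enum_val a)) /=; last first.
  by exists enum_rank => a _; rewrite ?enum_valK ?enum_rankK.
apply: eq_bigr => a _; rewrite !mxE.
by rewrite mevalZ mevalX mulrC.
Qed.

Lemma eval_free_point (f : {mpoly R[k * d]}) (i : 'I_k) (q : {ffun 'I_k -> 'rV[R]_d}) x :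
  eval_points f (upd q i x) = (free_point f i q).@[fun j => x 0 j].
Proof.
rewrite /free_point comp_mpoly_meval; apply: meval_eq => a.
rewrite tnth_mktuple; case/mxvec_indexP: a => i' j.
rewrite !mxvecE !mxE ffunE; case: eqP => [_|_]; first by rewrite mevalXU.
by rewrite mevalC.
Qed.

End Polynomials.

Lemma bin_gt1 d D : (0 < d)%N -> (0 < D)%N -> (1 < 'C(d + D, d))%N.
Proof.
case: d => // d _ D0; rewrite addSn binS.
by rewrite -[2%N]/(1 + 1)%N leq_add // bin_gt0; lia.
Qed.

Lemma vertex_lift (T : choiceType) (k : nat) (W : {fset T}) (Q : 'I_k -> {fset T})
    (p : 'I_k -> T) : (forall c, Q c `<=` W) -> (forall c, p c \in Q c) ->
  exists y : {ffun 'I_k -> W}, forall c, val (y c) = p c.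
Proof.
move=> QW pQ; exists [ffun c => [` fsubsetP (QW c) _ (pQ c)]] => c.
by rewrite ffunE.
Qed.

(** Every edge of a k-partite hypergraph comes from a tuple with one vertex in
    each part, so that the lower bound on the number of edges is one on the
    number of tuples. *)
Lemma density_hypergraph (R : realType) (d t D k : nat) (eps : R)
    (H : hypergraph 'rV[R]_d) (parts : 'I_k -> {fset 'rV[R]_d}) :
  let n := 'C(d + D, d) in let m := ('C(d + D, d) - 1)%N in
  (0 < d)%N -> (0 < t)%N -> (0 < D)%N -> 0 < eps ->
  kpartite H parts -> semialgebraic t D H parts ->
  eps * \prod_(i < k) (#|` parts i|)%:R <= (#|` edges H|)%:R ->
  exists parts' : 'I_k -> {fset 'rV[R]_d},
    [/\ forall i, parts' i `<=` parts i,
        forall i, eps ^+ n / (n%:R ^+ (20 * m * k) * t%:R ^+ m)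
                  * (#|` parts i|)%:R <= (#|` parts' i|)%:R
      & forall p : 'I_k -> 'rV[R]_d,
          (forall i, p i \in parts' i) -> edge_of p \in edges H].
Proof.
move=> n m d0 t0 D0 e0 [unif [pne pdis pcov] eparts] [f [Phi [fE fdeg]]] dens.
have n1 : (1 < n)%N := bin_gt1 d0 D0.
pose W := vertices H.
have PW c : parts c `<=` W by apply/fsubsetP => x xc; apply/pcov; exists c.
pose P c : {set W} := [set x | val x \in parts c].
have cardP (Q : {fset 'rV[R]_d}) : Q `<=` W -> #|[set x : W | val x \in Q]| = #|` Q|.
  by move=> QW; rewrite -(card_fsub QW); apply: eq_card => x; rewrite !inE.
have [z [l lP]] := spanning_nodes (0 : 'rV[R]_d) (@monomials R d D) (card_bmultinom d D).
have l1 x : \sum_a l x 0 a = 1.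
  have [a0 mon1] := monomials_const R d D.
  have := congr1 (fun y : 'rV[R]__ => y 0 a0) (lP x).
  rewrite mon1 summxE => ->; apply: eq_bigr => a _.
  by rewrite mxE mon1 mulr1.
pose G (j : 'I_t) (q : {ffun 'I_k -> 'rV[R]_d}) := eval_points (f j) q.
have sG j : separately_spanned (fun x : W => val x) z (fun x => l (val x)) (G j).
  move=> q i x; rewrite /G eval_free_point.
  have [c cE] := meval_monomials (fdeg j i q).
  rewrite cE lP dot_suml; apply: eq_bigr => a _.
  by rewrite dotZl -cE -eval_free_point.
pose Phi0 (b : {ffun 'I_t -> bool}) := Phi [tuple b j | j < t].
have holdsE (p : {ffun 'I_k -> W}) : p \in box P ->
    holds (fun x : W => val x) G Phi0 p = (edge_of (fun c => val (p c)) \in edges H).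
  rewrite inE => /forallP pP; rewrite fE; last by move=> c; have := pP c; rewrite inE.
  rewrite /holds /Phi0; congr Phi; apply: eq_from_tnth => j.
  rewrite !tnth_mktuple ffunE /G; congr (0 <= eval_points _ _).
  by apply: boolp.funext => c; rewrite ffunE.
have Pne c : (0 < #|P c|)%N by rewrite cardP // cardfs_gt0.
have [||A [AP As Ahold]] := @product_density R n k W _ _ z _ n1
  (fun x : W => l1 (val x)) P Pne _ G Phi0 eps sG e0.
- by rewrite card_ord.
- rewrite card_box natr_prod; under eq_bigr do rewrite cardP //.
  apply: le_trans dens _; rewrite ler_nat.
  pose E := [fset edge_of (fun c => val (p c)) | p : {ffun 'I_k -> W} in
               [set p in box P | holds (fun x : W => val x) G Phi0 p]].
  apply: (@leq_trans #|` E|); last first.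
    by apply: leq_trans (leq_imfset_card _ _ _) _; rewrite /= -cardE.
  apply: fsubset_leq_card; apply/fsubsetP => e eH.
  have eP c : exists x, x \in e `&` parts c.
    by apply/fset0Pn; rewrite -cardfs_gt0 eparts.
  have [p pE] := boolp.choice eP.
  have [|y yp] := @vertex_lift _ _ W parts p PW.
    by move=> c; have := pE c; rewrite inE => /andP[].
  have pinj : injective p.
    move=> c c' pcc; apply/eqP; apply: contraT => /pdis/fdisjointP/(_ (p c)).
    have := pE c; have := pE c'; rewrite !inE pcc => /andP[_ ->] /andP[_ ->] absurd.
    by have := absurd isT.
  have eE : e = edge_of p.
    apply/eqP; rewrite eq_sym eqEfcard; apply/andP; split.
      by apply/fsubsetP => _ /imfsetP[c /= _ ->]; have := pE c; rewrite inE => /andP[].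
    by rewrite unif // card_imfset //= -cardE card_ord.
  have eE' : e = edge_of (fun c => val (y c)).
    by rewrite eE; congr edge_of; apply: boolp.funext.
  have yB : y \in box P.
    rewrite inE; apply/forallP => c; rewrite inE yp.
    by have := pE c; rewrite inE => /andP[].
  apply/imfsetP; exists y => //=; rewrite inE yB holdsE // -eE' //.
exists (fun c => [fset val x | x in A c]); split.
- move=> c; apply/fsubsetP => _ /imfsetP[x /= xA ->].
  by have /fintype.subsetP/(_ x xA) := AP c; rewrite inE.
- move=> c; rewrite card_imfset; last exact: val_inj.
  have := As c; rewrite cardP // card_ord /m subn1 -cardE //.
- move=> p pA.
  have AW c : [fset val x | x in A c] `<=` W.
    by apply/fsubsetP => _ /imfsetP[x /= xA ->]; exact: fsvalP.
  have [y yp] := vertex_lift AW pA.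
  have yA c : y c \in A c.
    have := pA c; rewrite -yp => /imfsetP[x /= xA e].
    by have -> : y c = x by apply: val_inj.
  have yB : y \in box P.
    by rewrite inE; apply/forallP => c; apply: (fintype.subsetP (AP c)).
  have := Ahold y yA; rewrite holdsE //.
  have -> // : edge_of (fun c => val (y c)) = edge_of p.
  by congr edge_of; apply: boolp.funext.
Qed.
Theorem theorem1p1 (R : realType) (d t D : nat)
    (hd : (0 < d)%N) (ht : (0 < t)%N) (hD : (0 < D)%N) :
  let property (k : nat) (C : R) :=
    forall (eps : R) (H : hypergraph 'rV[R]_d)
        (parts : 'I_k -> {fset 'rV[R]_d}),
      0 < eps ->
      kpartite H parts ->
      semialgebraic t D H parts ->
      eps * \prod_(i < k) (#|` parts i|)%:R <= (#|` edges H|)%:R ->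
      exists parts' : 'I_k -> {fset 'rV[R]_d},
        [/\ forall i, parts' i `<=` parts i,
            forall i, eps ^+ 'C(d + D, d) / C ^+ k * (#|` parts i|)%:R
                      <= (#|` parts' i|)%:R
          & forall p : 'I_k -> 'rV[R]_d,
              (forall i, p i \in parts' i) -> edge_of p \in edges H] in
  (exists C : R, 0 < C /\ forall k : nat, (0 < k)%N -> property k C)
  /\
  (forall k : nat, (0 < k)%N ->
     let m := ('C(d + D, d) - 1)%N in
     property k (2 `^ (20 * m%:R * log2 (m.+1)%:R)
                 * t%:R `^ (m%:R / k%:R))).
Proof.
move=> property.
set m := ('C(d + D, d) - 1)%N in property *; set n := 'C(d + D, d) in property *.
have nm : m.+1 = n by rewrite /m subn1 prednK // bin_gt0 leq_addr.
have n_gt0 : 0 < n%:R :> R by rewrite -nm ltr0n.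
have t_ge1 : 1 <= t%:R :> R by rewrite ler1n.
have prop k (C : R) : 0 < C -> n%:R ^+ (20 * m * k) * t%:R ^+ m <= C ^+ k ->
    property k C.
  move=> C0 Cge eps H parts e0 kp sa dens.
  have [parts' [sub size edge]] := density_hypergraph hd ht hD e0 kp sa dens.
  exists parts'; split=> // i; apply: le_trans (size i); rewrite ler_wpM2r //.
  rewrite ler_wpM2l ?exprn_ge0 ?(ltW e0) // lef_pV2 // posrE ?exprn_gt0 //.
  by rewrite mulr_gt0 // exprn_gt0 // (lt_le_trans _ t_ge1).
split.
  exists (n%:R ^+ (20 * m) * t%:R ^+ m).
  split=> [|k k0]; first by rewrite mulr_gt0 // exprn_gt0 // (lt_le_trans _ t_ge1).
  apply: prop; first by rewrite mulr_gt0 // exprn_gt0 // (lt_le_trans _ t_ge1).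
  rewrite exprMn -!exprM ler_wpM2l ?exprn_ge0 ?(ltW n_gt0) //.
  by rewrite ler_weXn2l // leq_pmulr.
move=> k k0 m'; apply: prop.
  by rewrite mulr_gt0 // powR_gt0 // (lt_le_trans _ t_ge1).
have -> : 2 `^ (20 * m'%:R * log2 m'.+1%:R) = n%:R ^+ (20 * m) :> R.
  rewrite -powR_mulrn ?(ltW n_gt0) // -/m nm /powR pnatr_eq0 /= gt_eqF //.
  congr (sequences.expR _); rewrite /log2 natrM; field.
  by rewrite gt_eqF // ln_gt0 // ltr1n.
have tk : (t%:R `^ (m%:R / k%:R)) ^+ k = t%:R ^+ m :> R.
  rewrite -[LHS]powR_mulrn ?powR_ge0 // -powRrM divfK ?pnatr_eq0 -?lt0n //.
  by rewrite powR_mulrn.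
by rewrite exprMn -exprM [X in _ <= _ * X]tk.
Qed.
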